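(* Let $A$ generate a left-invertible $C_0$-semigroup on a Hilbert space $X$. Then for any Hilbert space $U$, $$\mathfrak{B}_{L^\infty}(A,U)=\mathfrak{B}_{L^2}(A,U).$$
   Context: All spaces are complex. Let $A$ generate a $C_0$-semigroup $(T(t))_{t\ge0}$ on $X$. The semigroup is left-invertible if each operator $T(t)$ has a bounded left inverse. $X_{-1}$ denotes the completion of $X$ with respect to the norm $\|(\beta-A)^{-1}\cdot\|_X$ for some fixed $\beta\in\rho(A)$ (the choice is immaterial); the semigroup extends uniquely to a $C_0$-semigroup on $X_{-1}$, again denoted $(T(t))_{t\ge0}$. $L(U,X_{-1})$ is the space of bounded linear operators from $U$ to $X_{-1}$. For $Z=L^p$, $p\in[1,\infty]$, an operator $B\in L(U,X_{-1})$ is called $Z$-admissible for $A$ if for all $t_0>0$ and all $u\in Z(0,t_0;U)$ one has $\int_0^{t_0}T(t_0-s)Bu(s)\,ds\in X$ (the integral being taken in $X_{-1}$). $\mathfrak{B}_Z(A,U)$ denotes the set of all $Z$-admissible $B\in L(U,X_{-1})$ for $A$. *)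

(* Defs.v *)
From HB Require Import structures.
From mathcomp Require Import all_boot all_order all_algebra sesquilinear.
From mathcomp Require Import complex.
From mathcomp Require Import all_classical all_reals all_analysis.

Set Implicit Arguments.
Unset Strict Implicit.
Unset Printing Implicit Defensive.

Import Order.TTheory GRing.Theory Num.Theory.
Import numFieldNormedType.Exports.

Local Open Scope classical_set_scope.
Local Open Scope complex_scope.
Local Open Scope ring_scope.

(* A complex Banach space is a [completeNormedModType R[i]].  Its norm takes
   values in [R[i]] (with zero imaginary part); [rnorm] is the same norm with
   values in [R]. *)
Definition rnorm (R : realType) (V : normedModType R[i]) (x : V) : R :=
  complex.Re `|x|.

Definition hilbert (R : realType) (V : completeNormedModType R[i]) : Prop :=
  exists dot : {dot V for Num.conj}, forall x : V, `|x| ^+ 2 = dot x x.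

Definition bounded_linear (R : realType) (V W : normedModType R[i])
    (f : V -> W) : Prop :=
  linear f /\ exists M : R, forall x, rnorm (f x) <= M * rnorm x.

(* Semigroups are total functions of a real time; only times [t >= 0] matter. *)
Definition C0_semigroup (R : realType) (X : completeNormedModType R[i])
    (T : R -> X -> X) : Prop :=
  [/\ forall t, 0 <= t -> bounded_linear (T t),
      forall x, T 0 x = x,
      forall s t x, 0 <= s -> 0 <= t -> T (s + t) x = T s (T t x) &
      forall x, T t x @[t --> 0^'+] --> x].

(* Unbounded operators are identified with their graphs:
   [A (x, y)] means [x \in D(A)] and [A x = y]. *)
Definition generator (R : realType) (X : completeNormedModType R[i])
    (T : R -> X -> X) : set (X * X)%type :=
  [set p | t^-1%:C *: (T t p.1 - p.1) @[t --> (0 : R)^'+] --> p.2].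

Definition generates (R : realType) (X : completeNormedModType R[i])
    (A : set (X * X)%type) (T : R -> X -> X) : Prop :=
  C0_semigroup T /\ A = generator T.

Definition left_invertible (R : realType) (X : completeNormedModType R[i])
    (T : R -> X -> X) : Prop :=
  forall t, 0 <= t ->
    exists2 S : X -> X, bounded_linear S & forall x, S (T t x) = x.

(* [S = (b - A)^-1]: the equation [(b - A) x = z], that is
   [A x = b x - z], holds exactly when [x = S z]. *)
Definition is_resolvent (R : realType) (X : completeNormedModType R[i])
    (A : set (X * X)%type) (b : R[i]) (S : X -> X) : Prop :=
  bounded_linear S /\ forall x z, A (x, b *: x - z) <-> x = S z.

(* [(Xm1, j)] is a completion of [X] for the norm [x |-> |(b - A)^-1 x|], for
   some [b] in the resolvent set of [A]; such a completion is unique up to a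
   unique isometric isomorphism compatible with the embeddings of [X]. *)
Definition extrapolation_space (R : realType) (X : completeNormedModType R[i])
    (A : set (X * X)%type) (Xm1 : completeNormedModType R[i])
    (j : X -> Xm1) : Prop :=
  exists b S, [/\ is_resolvent A b S, linear j,
                  forall x, `|j x| = `|S x| & dense (range j)].

Definition extends_semigroup (R : realType) (X Xm1 : completeNormedModType R[i])
    (j : X -> Xm1) (T : R -> X -> X) (Tm1 : R -> Xm1 -> Xm1) : Prop :=
  C0_semigroup Tm1 /\ forall t x, 0 <= t -> Tm1 t (j x) = j (T t x).

Section bochner.
Variable R : realType.
Local Notation mu := (@lebesgue_measure R).

Definition simple_fun (V : normedModType R[i]) (s : R -> V) : Prop :=
  finite_set (range s) /\ forall y, measurable (s @^-1` [set y]).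

(* For [D] of finite measure. *)
Definition simple_integral (V : normedModType R[i]) (D : set R)
    (s : R -> V) : V :=
  \sum_(y \in range s) (fine (mu (D `&` s @^-1` [set y])))%:C *: y.

(* As for the real-valued [Lfun] of the library, functions are Borel
   measurable, not merely almost everywhere equal to such a function; every
   class of almost everywhere equal Bochner measurable functions contains
   strongly measurable functions in this sense. *)
Definition strongly_measurable (V : normedModType R[i]) (D : set R)
    (f : R -> V) : Prop :=
  exists2 s : nat -> R -> V, forall n, simple_fun (s n) &
    forall x, D x -> s n x @[n --> \oo] --> f x.

Definition is_bochner_integral (V : completeNormedModType R[i]) (D : set R)
    (f : R -> V) (v : V) : Prop :=
  strongly_measurable D f /\
  exists s : nat -> R -> V,
    [/\ forall n, simple_fun (s n),
        (\int[mu]_(x in D) (rnorm (f x - s n x))%:E)%E @[n --> \oo] --> 0%E &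
        simple_integral D (s n) @[n --> \oo] --> v].

(* Representatives of the elements of [L^p(D; V)], for [1 <= p <= +oo]. *)
Definition LpB (V : normedModType R[i]) (p : \bar R) (D : set R) :
    set (R -> V) :=
  [set u | strongly_measurable D u /\
           finite_norm mu p (fun s => rnorm (u s) * \1_D s)].

End bochner.

(* The set of [L^p]-admissible operators in [L(U, Xm1)]; [x : X] is seen in
   [Xm1] as [j x]. *)
Definition admissible (R : realType) (X Xm1 : completeNormedModType R[i])
    (j : X -> Xm1) (Tm1 : R -> Xm1 -> Xm1) (U : completeNormedModType R[i])
    (p : \bar R) : set (U -> Xm1) :=
  [set B | bounded_linear B /\
     forall (t0 : R) (u : R -> U), 0 < t0 -> LpB p `]0, t0[ u ->
       exists x : X, is_bochner_integral `]0, t0[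
         (fun s => Tm1 (t0 - s) (B (u s))) (j x)].
Arguments admissible {R X Xm1} j Tm1 U p.

(* Main.v *)
Require Import Defs.
From HB Require Import structures.
From mathcomp Require Import all_boot all_order all_algebra sesquilinear.
From mathcomp Require Import complex ring lra zify.
From mathcomp Require Import all_classical all_reals all_analysis.
From mathcomp Require Import measurable_realfun ess_sup_inf.

(** L^2-admissibility implies L^oo-admissibility because L^oo is contained in
    L^2 on a bounded interval.  Conversely, if B is L^oo-admissible, the input
    map Phi_t : u |-> \int_0^t T(t - s) B u(s) ds is bounded from L^oo(0, t; U)
    to X by a closed graph argument.  As U and X are Hilbert spaces, Phi_t is
    then 2-summing (little Grothendieck inequality):
      sum_i |Phi_t u_i|^2 <= K sup_s sum_i |u_i(s)|^2.
    For a step function u on a grid of N cells of ]0, t0[, apply this on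
    ]0, 2 t0[ to the N translates of u by multiples of the mesh.  The right-hand
    side is K N |u|_{L^2}^2 / t0.  On the left, Phi_{2 t0} of a translate is
    T(r) Phi_{t0} u with 0 <= r <= t0, whose norm is at least c |Phi_{t0} u| by
    left-invertibility.  Hence |Phi_{t0} u| <= C |u|_{L^2} for step functions,
    which are dense in L^2, and X is complete. *)

Set Implicit Arguments.
Unset Strict Implicit.
Unset Printing Implicit Defensive.

Import Order.TTheory GRing.Theory Num.Theory.
Import numFieldNormedType.Exports.

Local Open Scope classical_set_scope.
Local Open Scope complex_scope.
Local Open Scope ring_scope.

(** * Norms with real values *)

(** The obstacle is that nothing bounds the state in [X] by the input directly: the integral
    converges only in the extrapolation space, and admissibility merely says that its value happens
    to come from [X]. The closed graph argument therefore rests on a semicontinuity: closed balls of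
    [X] stay closed in the weaker norm, so having a state of norm larger than [n] is an open
    condition on inputs, and a Baire argument applies. The balls are centered at simple functions
    because the limit of their centers is then strongly measurable, hence an admissible input. The
    summing inequality is used only on finite grids, but its constant must not depend on the number
    of cells. It starts from a crude bound that does depend on it; averaging over all choices of
    signs then halves the excess at each round, and the limit no longer sees the grid. Finally, a
    square integrable input has no state to begin with. Limits are taken in both spaces, of the
    states in [X] and of the integrals in the extrapolation space, and the continuity of [j]
    identifies them. *)

Section rnorm.
Variables (R : realType) (V : normedModType R[i]).
Implicit Types x y : V.

Lemma rnormE x : `|x| = (rnorm x)%:C.
Proof. by rewrite /rnorm RRe_real// normr_real. Qed.

Lemma rnorm_ge0 x : 0 <= rnorm x.
Proof. by rewrite -ler0c -rnormE. Qed.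

Lemma rnorm0 : rnorm (0 : V) = 0.
Proof. by rewrite /rnorm normr0. Qed.

Lemma rnorm_eq0 x : (rnorm x == 0) = (x == 0).
Proof. by rewrite -[RHS]normr_eq0 rnormE -(inj_eq (@complexI R)). Qed.

Lemma rnormD x y : rnorm (x + y) <= rnorm x + rnorm y.
Proof. by rewrite -lecR rmorphD/= -!rnormE ler_normD. Qed.

Lemma rnormN x : rnorm (- x) = rnorm x.
Proof. by rewrite /rnorm normrN. Qed.

Lemma rnormB x y : rnorm (x - y) <= rnorm x + rnorm y.
Proof. by rewrite -[rnorm y]rnormN rnormD. Qed.

Lemma rnorm_distC x y : rnorm (x - y) = rnorm (y - x).
Proof. by rewrite -rnormN opprB. Qed.

Lemma rnorm_distD z x y : rnorm (x - y) <= rnorm (x - z) + rnorm (z - y).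
Proof. by rewrite (le_trans _ (rnormD _ _))// addrA subrK. Qed.

Lemma rnormZ (c : R[i]) x : rnorm (c *: x) = complex.Re `|c| * rnorm x.
Proof.
apply: (@complexI R); rewrite -rnormE normrZ rnormE rmorphM/=.
by rewrite (RRe_real (normr_real c)).
Qed.

Lemma rnormZr (r : R) x : rnorm (r%:C *: x) = `|r| * rnorm x.
Proof. by rewrite rnormZ normc_def/= expr0n addr0 sqrtr_sqr. Qed.

Lemma rnorm_sum I (s : seq I) (P : pred I) (F : I -> V) :
  rnorm (\sum_(i <- s | P i) F i) <= \sum_(i <- s | P i) rnorm (F i).
Proof.
elim/big_rec2: _ => [|i a b _ ab]; first by rewrite rnorm0.
by rewrite (le_trans (rnormD _ _))// lerD2l.
Qed.

End rnorm.

(** The Hilbert structure enters through this identity alone; it is what the sums over signs and the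
    minimal norm argument consume. *)
Definition parallelogram (R : realType) (V : normedModType R[i]) :=
  forall x y : V, rnorm (x + y) ^+ 2 + rnorm (x - y) ^+ 2 =
                  (rnorm x ^+ 2 + rnorm y ^+ 2) *+ 2.

Lemma hilbert_parallelogram (R : realType) (V : completeNormedModType R[i]) :
  hilbert V -> parallelogram V.
Proof.
move=> [dot hdot] x y; apply: (@complexI R).
rewrite rmorphMn !rmorphD/= !rmorphXn/= -!rnormE !hdot.
rewrite !linearDl !linearDr/= linearNl !linearNr/= linearNl opprK.
rewrite mulr2n; ring.
Qed.

(** * The little Grothendieck inequality *)

Section rademacher.
Variable E : zmodType.

(** Rademacher sums: all signed sums of [s], listed with multiplicity. A sum over [rad s] is
    [2 ^ size s] times an expectation over independent signs. *)
Fixpoint rad (s : seq E) : seq E :=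
  if s is x :: s' then
    [seq x + y | y <- rad s'] ++ [seq x - y | y <- rad s']
  else [:: 0].

Lemma size_rad s : size (rad s) = (2 ^ size s)%N.
Proof.
by elim: s => //= x s IH; rewrite size_cat !size_map IH addnn -mul2n expnS.
Qed.

End rademacher.

Lemma rad_map (E F : zmodType) (f : E -> F) (s : seq E) :
  f 0 = 0 -> (forall x y, f (x + y) = f x + f y) ->
  (forall x y, f (x - y) = f x - f y) ->
  rad (map f s) = map f (rad s).
Proof.
move=> f0 fD fB; elim: s => [|x s IH] /=; first by rewrite f0.
rewrite IH map_cat -!map_comp.
by congr cat; apply: eq_map => y /=; rewrite ?fB ?fD.
Qed.

Section rademacher_moments.
Variables (R : realType) (V : normedModType R[i]).
Hypothesis hV : parallelogram V.
Implicit Types s : seq V.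

(** Each new vector enters with both signs, and the parallelogram law cancels the cross terms in
    pairs: orthogonality of the Rademacher variables. *)
Lemma rad_moment2 s :
  \sum_(y <- rad s) rnorm y ^+ 2 =
  2 ^+ size s * \sum_(x <- s) rnorm x ^+ 2 :> R.
Proof.
elim: s => [|x s IH] /=.
  by rewrite big_seq1 big_nil rnorm0 expr0n mulr0.
rewrite big_cat/= !big_map -big_split/=.
under eq_bigr do rewrite hV mulrnDl.
rewrite big_split/= big_const_seq count_predT size_rad iter_addr_0 big_cons.
rewrite sumrMnl IH (exprS _ (size s)) -[X in X + _]mulr_natl natrX.
by set N := 2 ^+ _; set S := \sum_(j <- s) _; ring.
Qed.

(** Khintchine's inequality for fourth moments, with the scalar constant 3. The identity (b + c)^4 +
    (b - c)^4 = 2 b^4 + 12 b^2 c^2 + 2 c^4 survives for norms as an upper bound, which the induction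
    sums over [y]. *)
Lemma rad_moment4 s :
  \sum_(y <- rad s) rnorm y ^+ 4 <=
  3 * 2 ^+ size s * (\sum_(x <- s) rnorm x ^+ 2) ^+ 2 :> R.
Proof.
elim: s => [|x s IH] /=.
  by rewrite big_seq1 big_nil rnorm0 expr0n /= expr0n mulr0.
rewrite big_cat/= !big_map -big_split/= big_cons.
set a := rnorm x ^+ 2; set S := \sum_(x <- s) _ in IH *.
have S0 : 0 <= S by apply: sumr_ge0 => i _; rewrite sqr_ge0.
have a0 : 0 <= a by rewrite sqr_ge0.
apply: (@le_trans _ _ (\sum_(y <- rad s)
    (2 * a ^+ 2 + 12 * a * rnorm y ^+ 2 + 2 * rnorm y ^+ 4))).
  apply: ler_sum => y _.
  have := hV x y; have := rnormD x y; have := rnormB x y.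
  have := rnorm_ge0 (x + y); have := rnorm_ge0 (x - y).
  have := rnorm_ge0 x; have := rnorm_ge0 y.
  rewrite /a; set p := rnorm (x + y); set q := rnorm (x - y).
  set b := rnorm x; set c := rnorm y => c0 b0 q0 p0 qle ple pq.
  have p2 : p ^+ 2 <= (b + c) ^+ 2 by rewrite lerXn2r// nnegrE addr_ge0.
  have q2 : q ^+ 2 <= (b + c) ^+ 2 by rewrite lerXn2r// nnegrE addr_ge0.
  have -> : p ^+ 4 = (p ^+ 2) ^+ 2 by rewrite -exprM.
  have -> : q ^+ 4 = (q ^+ 2) ^+ 2 by rewrite -exprM.
  have -> : q ^+ 2 = 2 * (b ^+ 2 + c ^+ 2) - p ^+ 2.
    by move: pq; rewrite mulr2n => pq; lra.
  set P := p ^+ 2 in pq p2 q2 *.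
  have bc0 : 0 <= b * c by rewrite mulr_ge0.
  (* This difference is twice the real part of the inner product of [x] and [y]; the two triangle
     inequalities stand in for Cauchy-Schwarz. *)
  have d1 : P - (b ^+ 2 + c ^+ 2) <= 2 * (b * c) by move: p2; rewrite sqrrD mulr2n; lra.
  have d2 : - (2 * (b * c)) <= P - (b ^+ 2 + c ^+ 2).
    by move: q2 pq; rewrite sqrrD !mulr2n; lra.
  have d3 : (P - (b ^+ 2 + c ^+ 2)) ^+ 2 <= (2 * (b * c)) ^+ 2.
    rewrite -ler_sqrt ?sqr_ge0// !sqrtr_sqr ler_norml.
    by rewrite (ger0_norm (mulr_ge0 _ bc0))// d1 d2.
  nra.
rewrite !big_split/= big_const_seq count_predT size_rad iter_addr_0.
rewrite -!big_distrr/= rad_moment2 -/S.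
rewrite -[X in X + _ + _ <= _]mulr_natl natrX.
apply: (@le_trans _ _ (2 ^+ size s * (2 * a ^+ 2)
   + 12 * a * (2 ^+ size s * S) + 2 * (3 * 2 ^+ size s * S ^+ 2))).
  by rewrite lerD2l ler_wpM2l.
have p0 : 0 <= (2 : R) ^+ size s by rewrite exprn_ge0.
rewrite (exprS _ (size s)) -subr_ge0; set N := 2 ^+ _ in p0 *.
rewrite [leRHS](_ : _ = N * (4 * a ^+ 2)); last ring.
by rewrite mulr_ge0// mulr_ge0// sqr_ge0.
Qed.

End rademacher_moments.

Section summing.
Variables (R : realType) (U X : normedModType R[i]).
Hypotheses (hU : parallelogram U) (hX : parallelogram X).
Variables (Phi : (nat -> U) -> X) (n : nat) (M : R).
Hypotheses (PhiD : forall u v : nat -> U, Phi (u + v) = Phi u + Phi v)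
           (PhiB : forall u v : nat -> U, Phi (u - v) = Phi u - Phi v).
Hypothesis PhiM : forall u (C : R), 0 <= C ->
  (forall k, (k < n)%N -> rnorm (u k) <= C) -> rnorm (Phi u) <= M * C.

Let summing (C : R) := forall (s : seq (nat -> U)) (m : R), 0 < m ->
  (forall k, (k < n)%N -> \sum_(u <- s) rnorm (u k) ^+ 2 <= m) ->
  \sum_(u <- s) rnorm (Phi u) ^+ 2 <= C * m.

(** Every coordinate of [u] is at most its Euclidean norm over the [n] coordinates. The constant is
    crude, but any finite one can start the iteration. *)
Let summing0 : summing (M ^+ 2 * n%:R).
Proof.
move=> s m m0 hs.
apply: (@le_trans _ _
    (\sum_(u <- s) M ^+ 2 * \sum_(k < n) rnorm (u k) ^+ 2)).
  apply: ler_sum => u _; set S := \sum_(k < n) _.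
  have S0 : 0 <= S by apply: sumr_ge0 => i _; rewrite sqr_ge0.
  rewrite -(sqr_sqrtr S0) -exprMn.
  have h : rnorm (Phi u) <= M * Num.sqrt S.
    apply: PhiM => [|k kn]; first exact: sqrtr_ge0.
    rewrite -[leLHS](ger0_norm (rnorm_ge0 _)) -sqrtr_sqr ler_sqrt//.
    rewrite /S (bigD1 (Ordinal kn))//= lerDl.
    by apply: sumr_ge0 => i _; rewrite sqr_ge0.
  by rewrite lerXn2r// nnegrE ?rnorm_ge0// (le_trans (rnorm_ge0 (Phi u)) h).
rewrite -big_distrr/= exchange_big/= -mulrA ler_wpM2l ?sqr_ge0//.
apply: (@le_trans _ _ (\sum_(k < n) m)); first by apply: ler_sum => k _; exact: hs.
by rewrite sumr_const card_ord mulr_natl.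
Qed.

Let trunc (c : R) (u : nat -> U) : nat -> U :=
  fun k => if rnorm (u k) ^+ 2 <= c then u k else 0.

(* Splitting the Rademacher sums into a bounded part, controlled by [M], and
   a tail, whose square function is small by the fourth moment bound. *)
Let summing_step (C : R) : 0 <= C -> summing C -> summing (24 * M ^+ 2 + C / 2).
Proof.
move=> C0 IH s m m0 hs.
have mX := rad_moment2 hX (map Phi s).
rewrite size_map big_map in mX.
rewrite (rad_map _ _ PhiD PhiB) ?big_map in mX; last first.
  by rewrite -(subrr (0 : nat -> U)) PhiB subrr.
set N := (2 : R) ^+ size s in mX.
have N0 : 0 < N by rewrite exprn_gt0.
rewrite -(ler_pM2l N0) -mX.
(* With the level 12 m, the square of a tail is at most |y k|^4 / (12 m), so the fourth moment bound
   sums the tails to N m / 4. The parallelogram law doubles both parts, whence 24 M^2 and C / 2. *)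
have c0 : 0 <= 12 * m by lra.
pose w (u : nat -> U) : nat -> U := u - trunc (12 * m) u.
apply: (@le_trans _ _ (\sum_(y <- rad s)
   (24 * M ^+ 2 * m + 2 * rnorm (Phi (w y)) ^+ 2))).
  apply: ler_sum => y _.
  have -> : Phi y = Phi (trunc (12 * m) y) + Phi (w y).
    by rewrite -PhiD; congr Phi; rewrite /w addrC subrK.
  have h1 : rnorm (Phi (trunc (12 * m) y)) <= M * Num.sqrt (12 * m).
    apply: PhiM => [|k kn]; first exact: sqrtr_ge0.
    rewrite -[leLHS](ger0_norm (rnorm_ge0 _)) -sqrtr_sqr ler_sqrt// /trunc.
    by case: ifPn => //; rewrite rnorm0 expr0n.
  have h2 : rnorm (Phi (trunc (12 * m) y)) ^+ 2 <= M ^+ 2 * (12 * m).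
    have -> : M ^+ 2 * (12 * m) = (M * Num.sqrt (12 * m)) ^+ 2.
      by rewrite exprMn sqr_sqrtr.
    rewrite lerXn2r// nnegrE ?rnorm_ge0//.
    exact: le_trans (rnorm_ge0 _) h1.
  have := hX (Phi (trunc (12 * m) y)) (Phi (w y)).
  have := sqr_ge0 (rnorm (Phi (trunc (12 * m) y) - Phi (w y))).
  by rewrite mulr2n; nra.
rewrite big_split/= big_const_seq count_predT size_rad iter_addr_0.
rewrite -big_distrr/= -[X in X + _ <= _]mulr_natl natrX -/N.
(* [summing C] is applied to the list of all [2 ^ size s] tails, which is why it quantifies over
   lists of any length. *)
have hw : \sum_(y <- rad s) rnorm (Phi (w y)) ^+ 2 <= C * (N * m / 4).
  have := IH (map w (rad s)) (N * m / 4); rewrite big_map; apply.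
    by rewrite divr_gt0// mulr_gt0.
  move=> k kn; rewrite big_map.
  have r4 : rad (map (fun u : nat -> U => u k) s) =
      map (fun u : nat -> U => u k) (rad s) by exact: rad_map.
  have := rad_moment4 hU (map (fun u : nat -> U => u k) s).
  rewrite {}r4 !big_map size_map -/N => r4.
  apply: (@le_trans _ _ (\sum_(y <- rad s) rnorm (y k) ^+ 4 / (12 * m))).
    apply: ler_sum => y _; rewrite (_ : w y k = y k - trunc (12 * m) y k)// /trunc.
    case: ifPn => [_|].
      by rewrite subrr rnorm0 expr0n/= divr_ge0// exprn_ge0// rnorm_ge0.
    rewrite -ltNge subr0 => h; rewrite ler_pdivlMr; last lra.
    by rewrite -[4%N]/(2 + 2)%N exprD ler_wpM2l ?sqr_ge0// ltW.
  rewrite -big_distrl/= ler_pdivrMr; last lra.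
  rewrite (le_trans r4)//.
  have := hs _ kn; set S := \sum_(u <- s) _ => Sm.
  have S0 : 0 <= S by apply: sumr_ge0 => i _; rewrite sqr_ge0.
  have S2 : S ^+ 2 <= m ^+ 2 by rewrite lerXn2r// nnegrE ltW.
  by rewrite [leRHS](_ : _ = 3 * N * m ^+ 2); [rewrite ler_wpM2l//; nra|field].
have : 2 * (C * (N * m / 4)) = N * (C / 2 * m) by field.
by rewrite mulrDl; nra.
Qed.

(** 48 M^2 is the fixed point of C |-> 24 M^2 + C / 2; iterating this contraction wipes out the
    dependence of the initial constant on [n]. *)
Lemma two_summing (s : seq (nat -> U)) (m : R) : 0 < m ->
  (forall k, (k < n)%N -> \sum_(u <- s) rnorm (u k) ^+ 2 <= m) ->
  \sum_(u <- s) rnorm (Phi u) ^+ 2 <= 48 * M ^+ 2 * m.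
Proof.
move=> m0 hs; set C0 := M ^+ 2 * n%:R.
have C00 : 0 <= C0 by rewrite mulr_ge0// sqr_ge0.
have M0 : 0 <= M ^+ 2 by rewrite sqr_ge0.
have h k : summing (48 * M ^+ 2 + C0 / 2 ^+ k).
  elim: k => [|k IH].
    move=> t c c0 ht; rewrite (le_trans (summing0 c0 ht))// expr0 divr1.
    by rewrite -/C0 ler_wpM2r//; [exact: ltW|nra].
  have := summing_step _ IH.
  rewrite (_ : 24 * M ^+ 2 + _ / 2 = 48 * M ^+ 2 + C0 / 2 ^+ k.+1); last first.
    by rewrite (exprS _ k); field; rewrite expf_neq0//.
  by apply; rewrite addr_ge0//; [nra|rewrite divr_ge0// exprn_ge0].
have lim : (fun k => (48 * M ^+ 2 + C0 / 2 ^+ k) * m) @ \oo -->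
    (48 * M ^+ 2 + C0 * 0) * m.
  apply: cvgM; last exact: cvg_cst.
  apply: cvgD; first exact: cvg_cst.
  apply: cvgM; first exact: cvg_cst.
  rewrite (_ : (fun k => _) = (fun k => 2^-1 ^+ k)); last first.
    by apply/funext => k; rewrite exprVn.
  by apply: cvg_expr; rewrite gtr0_norm// invf_lt1// ltr1n.
rewrite mulr0 addr0 in lim.
rewrite -(cvg_lim _ lim)//; apply: limr_ge; first by apply/cvg_ex; eexists; exact: lim.
by near=> k; exact: h.
Unshelve. all: by end_near. Qed.

End summing.

(** * Semigroup bounds and gliding humps *)

Section rnorm_convergence.
Variables (R : realType) (V : normedModType R[i]).

Lemma cvg_rnormP (T : Type) (F : set_system T) {FF : Filter F}
    (f : T -> V) (l : V) :
  f x @[x --> F] --> l <->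
  forall e : R, 0 < e -> \forall x \near F, rnorm (f x - l) < e.
Proof.
split=> [/cvgrPdist_lt h e e0|h].
  have : 0 < e%:C by rewrite ltcR.
  move=> /h; apply: filterS => x; rewrite rnormE ltcR.
  by rewrite rnorm_distC.
apply/cvgrPdist_lt => e; rewrite ltcE/= => /andP[/eqP e1 e0].
have := h _ e0; apply: filterS => x xe.
rewrite rnormE rnorm_distC (_ : e = (complex.Re e)%:C) ?ltcR//.
by case: e e1 {e0 xe} => /= a b ->.
Qed.

Lemma rnorm_lim_le (T : Type) (F : set_system T) {FF : ProperFilter F}
    (f : T -> V) (l c : V) (r : R) :
  f x @[x --> F] --> l ->
  (\forall x \near F, rnorm (f x - c) <= r) -> rnorm (l - c) <= r.
Proof.
move=> /cvg_rnormP fl fr; apply/ler_addgt0Pr => e e0.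
have [x [xr xe]] := @filter_ex _ F FF _ (filterI fr (fl _ e0)).
rewrite (le_trans (rnorm_distD (f x) _ _))// addrC lerD//.
by rewrite rnorm_distC ltW.
Qed.

End rnorm_convergence.

Lemma rnorm_cauchy_cvg (R : realType) (V : completeNormedModType R[i])
    (u : nat -> V) :
  (forall e : R, 0 < e -> exists N, forall n m, (N <= n)%N -> (N <= m)%N ->
    rnorm (u n - u m) < e) ->
  exists l : V, u n @[n --> \oo] --> l.
Proof.
move=> h; suff /cauchy_cvgP/cvg_ex : cauchy (u @ \oo) by [].
apply/cauchy_ballP => e; rewrite ltcE/= => /andP[/eqP e1 /h[N hN]].
exists ([set u n | n in [set n | (N <= n)%N]],
        [set u n | n in [set n | (N <= n)%N]]) => /=.
  by split; exists N => // n Nn; exists n.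
move=> [x y]/= [[n Nn <-] [m Nm <-]].
rewrite -ball_normE /ball_/= rnormE (_ : e = (complex.Re e)%:C) ?ltcR ?hN//.
by case: e e1 {hN} => /= a b ->.
Qed.

Section bounded_linear_maps.
Variables (R : realType) (V W : normedModType R[i]) (f : V -> W).
Hypothesis lf : linear f.

Lemma linD x y : f (x + y) = f x + f y.
Proof. by have := lf 1 x y; rewrite !scale1r. Qed.

Lemma lin0 : f 0 = 0.
Proof. by apply: (@addrI _ (f 0)); rewrite -linD !addr0. Qed.

Lemma linZ a x : f (a *: x) = a *: f x.
Proof. by have := lf a x 0; rewrite !addr0 lin0 addr0. Qed.

Lemma linN x : f (- x) = - f x.
Proof. by rewrite -scaleN1r linZ scaleN1r. Qed.

Lemma linB x y : f (x - y) = f x - f y.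
Proof. by rewrite linD linN. Qed.

Lemma lin_sum I (s : seq I) (P : pred I) (F : I -> V) :
  f (\sum_(i <- s | P i) F i) = \sum_(i <- s | P i) f (F i).
Proof. by apply: (big_morph f linD lin0). Qed.

End bounded_linear_maps.

Lemma bounded_linear_gt0 (R : realType) (V W : normedModType R[i]) (f : V -> W) :
  bounded_linear f ->
  exists2 M : R, 0 < M & forall x, rnorm (f x) <= M * rnorm x.
Proof.
move=> [_ [M hM]]; exists (`|M| + 1); first by rewrite ltr_wpDl.
move=> x; rewrite (le_trans (hM x))// ler_wpM2r ?rnorm_ge0//.
by rewrite (le_trans (ler_norm M))// lerDl.
Qed.

Lemma bounded_linear_cvg (R : realType) (V W : normedModType R[i]) (f : V -> W)
    (T : Type) (F : set_system T) {FF : Filter F} (g : T -> V) (l : V) :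
  bounded_linear f -> g x @[x --> F] --> l -> f (g x) @[x --> F] --> f l.
Proof.
move=> bf /cvg_rnormP gl; have [M M0 hM] := bounded_linear_gt0 bf.
apply/cvg_rnormP => e e0; have := gl (e / M); rewrite divr_gt0// => /(_ isT).
apply: filterS => x; rewrite ltr_pdivlMr// mulrC; apply: le_lt_trans.
by rewrite -(linB bf.1) hM.
Qed.

(* A Baire category argument for the uniform metric on functions [I -> V],
   in which the centers of the balls may be chosen in a given set [S]. *)
Lemma nested_balls (R : realType) (V : completeNormedModType R[i]) (I : Type)
    (S : set (I -> V)) (O : nat -> set (I -> V)) (f0 : I -> V) :
  S f0 ->
  (forall n f (r : R), S f -> 0 < r -> exists f' (r' : R),
    [/\ S f', 0 < r' <= r / 2, forall i, rnorm (f' i - f i) <= r / 2 &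
        forall g, (forall i, rnorm (g i - f' i) <= r') -> O n g]) ->
  exists (g : I -> V) (s : nat -> I -> V), [/\ forall n, S (s n),
     forall i, s n i @[n --> \oo] --> g i,
     forall i, rnorm (g i - f0 i) <= 1 & forall n, O n g].
Proof.
move=> Sf0 step.
have /choice[nxt nxtP] (p : nat * ((I -> V) * R)) :
    exists q : (I -> V) * R, S p.2.1 -> 0 < p.2.2 ->
    [/\ S q.1, 0 < q.2 <= p.2.2 / 2,
     forall i, rnorm (q.1 i - p.2.1 i) <= p.2.2 / 2 &
     forall g, (forall i, rnorm (g i - q.1 i) <= q.2) -> O p.1 g].
  case: p => [n [f r]] /=; have [Sf|nSf] := pselect (S f); last by exists (f, r).
  have [r0|r0] := ltP 0 r; last by exists (f, r) => _; rewrite ltNge r0.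
  by have [f' [r' h]] := step n f r Sf r0; exists (f', r').
pose st := fix st n := if n is n'.+1 then nxt (n', st n') else (f0, 1).
have stP n : S (st n).1 /\ 0 < (st n).2.
  elim: n => [|n [h1 h2]] //=.
  by have [] := nxtP (n, st n) h1 h2 => /= ? /andP[].
have stS n : [/\ (st n.+1).2 <= (st n).2 / 2,
    forall i, rnorm ((st n.+1).1 i - (st n).1 i) <= (st n).2 / 2 &
    forall g, (forall i, rnorm (g i - (st n.+1).1 i) <= (st n.+1).2) -> O n g].
  by have [h1 h2] := stP n; have [? /andP[]] := nxtP (n, st n) h1 h2.
(* The balls are nested: a center moves by at most half the radius, and the new radius is at most
   the other half. *)
have dist n k i : rnorm ((st (n + k)%N).1 i - (st n).1 i) <=
    (st n).2 - (st (n + k)%N).2.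
  elim: k => [|k IH]; first by rewrite addn0 !subrr rnorm0.
  rewrite addnS (le_trans (rnorm_distD ((st (n + k)%N).1 i) _ _))//.
  have [h1 h2 _] := stS (n + k)%N.
  by have := h2 i; lra.
have dist2 n k i : (n <= k)%N -> rnorm ((st k).1 i - (st n).1 i) <= (st n).2.
  move=> nk; have := dist n (k - n)%N i; rewrite subnKC//.
  by have [_] := stP k; lra.
have r2 n : (st n).2 <= 2^-1 ^+ n.
  elim: n => [|n IH] //; have [h _ _] := stS n.
  by rewrite exprS; lra.
have small (e : R) : 0 < e -> exists N, (st N).2 < e.
  move=> e0; have [N _ hN] : \forall n \near \oo, (2^-1 : R) ^+ n < e.
    have := @cvg_expr R 2^-1; rewrite gtr0_norm// invf_lt1// ltr1n => /(_ isT).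
    move=> /cvgrPdist_lt/(_ e e0); apply: filterS => n.
    by rewrite sub0r normrN; exact/le_lt_trans/ler_norm.
  by exists N; rewrite (le_lt_trans (r2 N))// hN/=.
have /choice[g hg] (i : I) : exists l : V, (st n).1 i @[n --> \oo] --> l.
  apply: rnorm_cauchy_cvg => e e0.
  have /small[N hN] : 0 < e / 2 by rewrite divr_gt0.
  exists N => n m Nn Nm; rewrite (le_lt_trans (rnorm_distD ((st N).1 i) _ _))//.
  rewrite [rnorm (_ - (st m).1 i)]rnorm_distC.
  by have := dist2 _ _ i Nn; have := dist2 _ _ i Nm; lra.
have close n i : rnorm (g i - (st n).1 i) <= (st n).2.
  by apply: (rnorm_lim_le (hg i)); exists n => // k /= nk; exact: dist2.
exists g, (fun n => (st n).1); split => [n|//|i|n].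
- by have [] := stP n.
- exact: (close 0%N).
- by have [_ _] := stS n; apply => i; exact: close.
Qed.

Lemma natr_gt (R : archiRealFieldType) (x : R) : exists N : nat, x < N%:R.
Proof.
by exists (Num.bound `|x|); rewrite (le_lt_trans (ler_norm x))// archi_boundP.
Qed.

(** * Uniform bounds and right continuity of C_0-semigroups *)

Section semigroup_bounds.
Variables (R : realType) (X : completeNormedModType R[i]) (T : R -> X -> X).
Hypothesis hT : C0_semigroup T.

Let T_linear t : 0 <= t -> linear (T t).
Proof. by case: hT => h _ _ _ /h[]. Qed.

Let T_cvg0 x (e : R) : 0 < e ->
  exists2 d : R, 0 < d & forall t, 0 <= t < d -> rnorm (T t x - x) < e.
Proof.
case: hT => _ T0 _ /(_ x)/cvg_rnormP h e0.
have [d /= d0 hd] := h _ e0; exists d => // t /andP[t0 td].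
move: t0; rewrite le_eqVlt => /orP[/eqP <-|t0]; first by rewrite T0 subrr rnorm0.
by apply: hd => //=; rewrite sub0r normrN gtr0_norm.
Qed.

(** Uniform boundedness near time 0. Otherwise nested balls of [X], seen as functions on [unit],
    would produce a point whose orbit is unbounded along times tending to 0, against strong
    continuity there. *)
Let semigroup_bound0 : exists d M : R, [/\ 0 < d, 1 <= M &
  forall t x, 0 <= t <= d -> rnorm (T t x) <= M * rnorm x].
Proof.
apply: contrapT => nb.
have nb' (d M : R) : 0 < d -> exists t x,
    0 <= t <= d /\ M * rnorm x < rnorm (T t x).
  move=> d0; apply: contrapT => h; apply: nb; exists d, (`|M| + 1).
  split => // [|t x td]; first by rewrite lerDr.
  rewrite leNgt; apply/negP => hx; apply: h; exists t, x; split => //.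
  rewrite (le_lt_trans _ hx)// ler_wpM2r ?rnorm_ge0//.
  by rewrite (le_trans (ler_norm M))// lerDl.
pose O (n : nat) : set (unit -> X) := [set g | exists t,
  0 <= t <= n.+1%:R^-1 /\ n%:R <= rnorm (T t (g tt))].
have [//|n f r _ r0|g [s [_ _ _ hO]]] :=
    @nested_balls R X unit setT O (fun=> 0); last first.
  have [d d0 hd] := T_cvg0 (g tt) ltr01.
  have [N Nd] := natr_gt (d^-1 + rnorm (g tt) + 1).
  have gt0 := rnorm_ge0 (g tt).
  have d10 : 0 < d^-1 by rewrite invr_gt0.
  have [t [/andP[t0 tN] hN]] := hO N.
  have td : t < d.
    rewrite (le_lt_trans tN)// -[ltRHS]invrK ltf_pV2 ?posrE//.
    by rewrite -natr1; lra.
  have := hd t; rewrite t0 td => /(_ isT).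
  by have := rnorm_distD 0 (T t (g tt)) (g tt);
    have := rnormD (T t (g tt) - g tt) (g tt); rewrite subrK; lra.
have [|t [x [/andP[t0 tn]]]] := nb' n.+1%:R^-1 (2 * n.+1%:R / r).
  by rewrite invr_gt0.
have lT := T_linear t0.
have [bT _ _ _] := hT; have [K K0 hK] := bounded_linear_gt0 (bT _ t0).
move=> hx; have x0 : 0 < rnorm x.
  rewrite lt0r rnorm_eq0 rnorm_ge0 andbT; apply/eqP => x0.
  by move: hx; rewrite x0 (lin0 lT) !rnorm0 mulr0 ltxx.
pose h : X := (r / 2 / rnorm x)%:C *: x.
have hr : rnorm h = r / 2.
  by rewrite /h rnormZr gtr0_norm ?divfK ?gt_eqF// !divr_gt0.
have Th : n.+1%:R <= rnorm (T t h).
  rewrite /h (linZ lT) rnormZr gtr0_norm ?divr_gt0//.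
  have -> : n.+1%:R = r / 2 / rnorm x * (2 * n.+1%:R / r * rnorm x).
    by field; rewrite !gt_eqF.
  by rewrite ler_pM2l ?divr_gt0// ltW.
(* [T t h] is half the difference of the images of [f tt + h] and [f tt - h], so one of these images
   is at least as large as [T t h]. *)
have [f' [ff' Tf']] : exists f' : X, rnorm (f' - f tt) = r / 2 /\
    n.+1%:R <= rnorm (T t f').
  have [h1|h1] := leP n.+1%:R (rnorm (T t (f tt + h))).
    by exists (f tt + h); rewrite addrAC subrr add0r.
  exists (f tt - h); rewrite addrAC subrr add0r rnormN; split => //.
  have : rnorm (T t h *+ 2) <= rnorm (T t (f tt + h)) + rnorm (T t (f tt - h)).
    rewrite (_ : T t h *+ 2 = T t (f tt + h) - T t (f tt - h)) ?rnormB//.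
    by rewrite (linD lT) (linB lT) opprB addrC addrA subrK mulr2n.
  rewrite -scaler_nat (_ : 2 = (2 : R)%:C) ?rnormZr; last by rewrite rmorph_nat.
  by rewrite ger0_norm//; lra.
(* On a ball of radius [K^-1] the values of [T t] vary by at most 1, which lowers the bound from
   [n.+1] to [n]. *)
pose r' := Num.min (r / 2) K^-1.
have r'0 : 0 < r' by rewrite lt_min invr_gt0 K0 divr_gt0.
exists (fun=> f'), r'; split => //.
- by rewrite r'0 ge_min lexx.
- by move=> []; rewrite ff'.
- move=> g /(_ tt) hg; exists t; split; first by rewrite t0 tn.
  have : rnorm (T t (g tt - f')) <= 1.
    rewrite (le_trans (hK _))// -(mulfV (lt0r_neq0 K0)) ler_pM2l//.
    by rewrite (le_trans hg)// ge_min lexx orbT.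
  have := rnormB (T t (g tt)) (T t (g tt - f')).
  rewrite (linB lT) opprB addrCA subrr addr0.
  by rewrite -natr1 in Tf'; lra.
Qed.

Lemma semigroup_bound (tau : R) : exists2 M : R, 0 < M &
  forall t x, 0 <= t <= tau -> rnorm (T t x) <= M * rnorm x.
Proof.
have [d [M [d0 M1 hM]]] := semigroup_bound0.
have h (n : nat) : exists2 K : R, 1 <= K &
    forall t x, 0 <= t <= n%:R * d -> rnorm (T t x) <= K * rnorm x.
  elim: n => [|n [K K1 hK]].
    exists 1 => // t x; rewrite mul0r -eq_le => /eqP <-.
    by case: hT => _ -> _ _; rewrite mul1r.
  exists (K * M) => [|t x /andP[t0 tn]]; first exact: mulr_ege1.
  have x0 := rnorm_ge0 x.
  have [tn'|tn'] := leP t (n%:R * d).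
    rewrite (le_trans (hK t x _)) ?t0// ler_wpM2r// ler_peMr// (le_trans _ K1)//.
  have [td|td] := leP t d.
    rewrite (le_trans (hM t x _)) ?t0// ler_wpM2r// ler_peMl// (le_trans _ M1)//.
  have [_ _ TD _] := hT.
  rewrite -(subrK d t) TD ?subr_ge0 ?(ltW d0) ?(ltW td)//.
  rewrite (le_trans (hK _ _ _))//.
    by rewrite subr_ge0 ltW//= lerBlDr (le_trans tn)// -natr1 mulrDl mul1r.
  rewrite -mulrA ler_wpM2l ?(le_trans _ K1)//.
  by rewrite hM// lexx ltW.
have [N hN] := natr_gt (tau / d); have [K K1 hK] := h N.
exists K => [|t x /andP[t0 tt]]; first exact: lt_le_trans K1.
by apply: hK; rewrite t0/= (le_trans tt)// -ler_pdivrMr// (ltW hN).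
Qed.

(** As [T tau] factors as [T (tau - t)] after [T t], a left inverse at the single time [tau] gives a
    constant valid for all earlier times. *)
Lemma left_invertible_lower_bound (tau : R) : 0 <= tau -> left_invertible T ->
  exists2 c : R, 0 < c & forall t x, 0 <= t <= tau ->
    c * rnorm x <= rnorm (T t x).
Proof.
move=> tau0 /(_ _ tau0)[S /bounded_linear_gt0[K K0 hK] ST].
have [M M0 hM] := semigroup_bound tau.
exists (K * M)^-1 => [|t x /andP[t0 tt]]; first by rewrite invr_gt0 mulr_gt0.
rewrite ler_pdivrMl ?mulr_gt0// -{1}(ST x) (le_trans (hK _))//.
rewrite -mulrA ler_pM2l// -(subrK t tau).
have [_ _ TD _] := hT; rewrite TD ?subr_ge0//.
by rewrite hM// subr_ge0 tt/= lerBlDr lerDl.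
Qed.

(** Joint continuity, with times approached from the right: there [T (t + h n)] splits as [T t]
    after [T (h n)], and strong continuity at 0 suffices. *)
Lemma semigroup_cvg (t : R) (h : nat -> R) (y : nat -> X) (l : X) :
  0 <= t -> (forall n, 0 <= h n) -> h n @[n --> \oo] --> (0 : R) ->
  y n @[n --> \oo] --> l -> T (t + h n) (y n) @[n --> \oo] --> T t l.
Proof.
move=> t0 h0 h_cvg /cvg_rnormP y_cvg.
have [bT _ TD _] := hT.
rewrite (_ : (fun n => _) = (fun n => T t (T (h n) (y n)))); last first.
  by apply/funext => n; rewrite TD.
apply: bounded_linear_cvg; first exact: bT.
have [M M0 hM] := semigroup_bound 1.
apply/cvg_rnormP => e e0.
have [|d d0 hd] := T_cvg0 l (e := e / 2); first by rewrite divr_gt0.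
have hsmall (c : R) : 0 < c -> \forall n \near \oo, h n < c.
  move/cvgrPdist_lt : h_cvg => hc c0; move: (hc c c0); apply: filterS => n.
  by rewrite sub0r normrN ger0_norm.
have := y_cvg (e / 2 / M); rewrite !divr_gt0// => /(_ isT) y1.
near=> n.
rewrite (le_lt_trans (rnorm_distD (T (h n) l) _ _))//.
rewrite (splitr e) ltrD//; last by apply: hd; rewrite h0/=; near: n; exact: hsmall.
rewrite -(linB (T_linear (h0 n))).
rewrite (le_lt_trans (hM _ _ _))//; first by rewrite h0/= ltW//; near: n; exact: hsmall.
by rewrite -ltr_pdivlMl// mulrC; near: n.
Unshelve. all: by end_near. Qed.

End semigroup_bounds.

(* Closed balls of a Hilbert space stay closed for any weaker norm: take
   elements of almost minimal norm in smaller and smaller neighbourhoods of [x];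
   they form a Cauchy sequence by the parallelogram law. *)
Lemma weak_norm_le (R : realType) (X : completeNormedModType R[i])
    (Y : normedModType R[i]) (j : X -> Y) (x : X) (m : R) :
  parallelogram X -> bounded_linear j -> injective j -> 
  (forall d : R, 0 < d -> exists2 y, rnorm y <= m & rnorm (j y - j x) < d) ->
  rnorm x <= m.
Proof.
move=> hX bj ij near_x; have lj := bj.1.
have [K K0 hK] := bounded_linear_gt0 bj.
pose B (n : nat) := [set y | rnorm (j y - j x) < n.+1%:R^-1].
pose N2 (n : nat) := [set rnorm y ^+ 2 | y in B n].
have [z zP] : exists z : nat -> X, forall n, rnorm (z n) <= m /\ B n (z n).
  have h (n : nat) : exists z, rnorm z <= m /\ B n z.
    by have [|z z1 z2] := near_x n.+1%:R^-1; [rewrite invr_gt0|exists z].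
  by have [z] := choice h; exists z.
have m0 : 0 <= m by have [+ _] := zP 0%N; apply: le_trans; exact: rnorm_ge0.
have lbN n : lbound (N2 n) 0 by move=> _ [y _ <-]; exact: sqr_ge0.
have infN n : has_inf (N2 n).
  by split; [exists (rnorm (z n) ^+ 2), (z n) => //; have [] := zP n|exists 0].
have inf_le n y : B n y -> inf (N2 n) <= rnorm y ^+ 2.
  by move=> By; apply: ge_inf; [exists 0|exists y].
have inf_m n : inf (N2 n) <= m ^+ 2.
  rewrite (le_trans (inf_le n (z n) _))//; first by have [] := zP n.
  by rewrite lerXn2r ?nnegrE ?rnorm_ge0//; have [] := zP n.
have subB n k y : (n <= k)%N -> B k y -> B n y.
  move=> nk; rewrite /B /= => /lt_le_trans; apply.
  by rewrite lef_pV2 ?posrE// ler_nat ltnS.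
have [y yP] : exists y : nat -> X, forall n,
    [/\ rnorm (y n) <= m, B n (y n) & rnorm (y n) ^+ 2 < inf (N2 n) + n.+1%:R^-1].
  have h (n : nat) : exists y, [/\ rnorm y <= m, B n y &
      rnorm y ^+ 2 < inf (N2 n) + n.+1%:R^-1].
    have [|_ [y By <-] yl] := inf_adherent (eps := n.+1%:R^-1) _ (infN n).
      by rewrite invr_gt0.
    have [ym|ym] := leP (rnorm y) m; first by exists y.
    have [z1 z2] := zP n; exists (z n); split => //.
    rewrite (le_lt_trans _ yl)// lerXn2r ?nnegrE ?rnorm_ge0//.
    exact: le_trans z1 (ltW ym).
  by have [y] := choice h; exists y.
pose D := sup [set inf (N2 n) | n in setT].
have hD : has_sup [set inf (N2 n) | n in setT].
  by split; [exists (inf (N2 0%N)), 0%N|exists (m ^+ 2) => _ [n _ <-]].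
have inf_D n : inf (N2 n) <= D by apply: sup_ubound; [case: hD|exists n].
have [l yl] : exists l : X, y n @[n --> \oo] --> l.
  apply: rnorm_cauchy_cvg => e e0.
  (* Put eps = e^2 / 16. The midpoint of [y n] and [y k] lies in [B n1], so its squared norm exceeds
     D - eps, and the parallelogram law gives |y n - y k|^2 < 4 (D + eps) - 4 (D - eps) = e^2 /
     2. *)
  have e2 : 0 < e ^+ 2 / 16 by rewrite divr_gt0// exprn_gt0.
  have [_ [n1 _ <-] n1D] := sup_adherent e2 hD.
  have [n2 hn2] : exists n2 : nat, n2.+1%:R^-1 < e ^+ 2 / 16.
    have [N hN] := natr_gt (e ^+ 2 / 16)^-1; exists N.
    rewrite -[ltRHS]invrK ltf_pV2 ?posrE ?invr_gt0//.
    by rewrite (lt_trans hN)// ltr_nat.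
  exists (maxn n1 n2) => n k nn kk.
  have yn i : (maxn n1 n2 <= i)%N -> rnorm (y i) ^+ 2 < D + e ^+ 2 / 16.
    move=> ii; have [_ _ h] := yP i; rewrite (lt_le_trans h)// lerD//.
    rewrite (le_trans _ (ltW hn2))// lef_pV2 ?posrE// ler_nat ltnS.
    by rewrite (leq_trans _ ii)// leq_maxr.
  have Bi i : (maxn n1 n2 <= i)%N -> B n1 (y i).
    move=> ii; have [_ h _] := yP i; apply: subB h.
    by rewrite (leq_trans _ ii)// leq_maxl.
  have half : (2^-1 : R)%:C *: (y n + y k) =
      (2^-1 : R)%:C *: y n + (2^-1 : R)%:C *: y k.
    by rewrite scalerDr.
  have halfK (w : Y) : w = (2^-1 : R)%:C *: w + (2^-1 : R)%:C *: w.
    by rewrite -scalerDl -rmorphD/= (_ : 2^-1 + 2^-1 = 1) ?scale1r//; lra.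
  have Bmid : B n1 ((2^-1 : R)%:C *: (y n + y k)).
    rewrite /B/= half (linD lj) !(linZ lj).
    rewrite (halfK (j x)) opprD addrACA -!scalerBr.
    rewrite (le_lt_trans (rnormD _ _))// !rnormZr ger0_norm//.
    have := Bi _ nn; have := Bi _ kk; rewrite /B/=.
    by move: (n1.+1%:R^-1) => q; lra.
  have := inf_le _ _ Bmid; rewrite rnormZr ger0_norm// exprMn => hmid.
  have := yn _ nn; have := yn _ kk; have := hX (y n) (y k).
  rewrite mulr2n => pl y1 y2.
  have : rnorm (y n - y k) ^+ 2 < e ^+ 2.
    by move: pl hmid n1D; rewrite -/D; lra.
  by rewrite ltr_pXn2r ?nnegrE ?rnorm_ge0// ltW.
have -> : x = l.
  apply: ij; apply/eqP; rewrite -subr_eq0 -rnorm_eq0 eq_le rnorm_ge0 andbT.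
  rewrite rnorm_distC.
  apply/ler_addgt0Pl => e e0; rewrite addr0.
  apply: (rnorm_lim_le (bounded_linear_cvg bj yl)).
  have [N hN] := natr_gt e^-1.
  exists N => // n /= nn; have [_ + _] := yP n.
  move=> /ltW/le_trans; apply; rewrite -[leRHS]invrK lef_pV2 ?posrE ?invr_gt0//.
  by rewrite ltW// (lt_le_trans hN)// ler_nat ltnW.
rewrite -[l]subr0; apply: (rnorm_lim_le yl).
by exists 0%N => // n _ /=; rewrite subr0; have [] := yP n.
Qed.

(** * Bochner integrals *)

Section finitely_valued.
Variable R : realType.
Local Notation mu := (@lebesgue_measure R).

(* The list [r] may contain more than the values of [s]. *)
Definition fsimple (Z : eqType) (s : R -> Z) (r : seq Z) :=
  [/\ uniq r, forall x, s x \in r & forall z, measurable (s @^-1` [set z])].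

Lemma simple_funP (V : normedModType R[i]) (s : R -> V) :
  simple_fun s <-> exists r, fsimple s r.
Proof.
split=> [[fs ms]|[r [ur sr ms]]]; last first.
  split=> //; apply: (@sub_finite_set _ _ [set` r]) => // _ [x _ <-] /=.
  exact: sr.
exists (finmap.enum_fset (fset_set (range s))); split => // [|x].
  exact: finmap.fset_uniq.
by rewrite in_fset_set// inE; exists x.
Qed.

Section maps.
Variables (Z W : eqType) (s : R -> Z) (r : seq Z) (t : R -> W) (q : seq W).
Hypotheses (hs : fsimple s r) (ht : fsimple t q).

Lemma fsimple_preimage (A : set Z) : measurable (s @^-1` A).
Proof.
have [ur sr ms] := hs.
rewrite (_ : s @^-1` A = \bigcup_(z in [set` r] `&` A) s @^-1` [set z]).
  by apply: fin_bigcup_measurable => [|z _]; [exact: finite_setIl|exact: ms].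
apply/seteqP; split=> [x Ax|x [z [_ Az] /= xz]]; last by rewrite /preimage/= xz.
by exists (s x) => //; split => //; exact: sr.
Qed.

Lemma fsimple_comp (W' : eqType) (F : Z -> W') :
  fsimple (F \o s) (undup (map F r)).
Proof.
have [ur sr ms] := hs; split => [|x|z]; first exact: undup_uniq.
  by rewrite mem_undup/= map_f.
by rewrite comp_preimage; exact: fsimple_preimage.
Qed.

Lemma fsimple_pair : fsimple (fun x => (s x, t x)) (allpairs pair r q).
Proof.
have [ur sr ms] := hs; have [uq tq mt] := ht; split => [|x|[z w]].
- by apply: allpairs_uniq => // -[? ?] [? ?] _ _ [-> ->].
- by apply/allpairsP; exists (s x, t x); split => /=.
- rewrite (_ : _ @^-1` _ = s @^-1` [set z] `&` t @^-1` [set w]).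
    exact: measurableI.
  by apply/seteqP; split => x /= [-> ->].
Qed.

Lemma fsimple_shift (a : R) : fsimple (fun x => s (x - a)) r.
Proof.
have [ur sr ms] := hs; split => // z.
rewrite -[_ @^-1` _](setTI).
rewrite (_ : _ @^-1` _ = (fun x => x - a) @^-1` (s @^-1` [set z]))//.
have : measurable_fun setT (fun x : R => x - a) by exact: measurable_funB.
by apply => //; exact: ms.
Qed.

Lemma measurable_fsimple (D : set R) (f : Z -> R) :
  measurable D -> measurable_fun D (f \o s).
Proof.
move=> mD _ Y mY; rewrite comp_preimage.
by apply: measurableI => //; exact: fsimple_preimage.
Qed.

End maps.

Lemma fsimple_mem (E : set R) : measurable E ->
  fsimple (fun x => x \in E) [:: true; false].
Proof.
move=> mE; split => // [x|b]; first by case: (x \in E).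
case: b.
  by rewrite (_ : _ @^-1` _ = E)//; apply/seteqP; split => x /= => [/set_mem|/mem_set].
rewrite (_ : _ @^-1` _ = ~` E); first exact: measurableC.
by apply/seteqP; split => x /= xE; [move=> /mem_set; rewrite xE|apply/memNset].
Qed.

Section integrals.
Variable D : set R.
Hypotheses (mD : measurable D) (finD : (mu D < +oo)%E).

Lemma fin_muI (A : set R) : measurable A -> mu (D `&` A) \is a fin_num.
Proof.
move=> mA; rewrite ge0_fin_numE//; apply: le_lt_trans finD.
by apply: le_measure; rewrite ?inE//; exact: measurableI.
Qed.

Lemma integral_fsimple (Z : eqType) (c : R -> Z) (r : seq Z) (G : Z -> R) :
  fsimple c r -> (forall z, 0 <= G z) ->
  (\int[mu]_(x in D) (G (c x))%:E)%E =
  (\sum_(z <- r) fine (mu (D `&` c @^-1` [set z])) * G z)%:E.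
Proof.
move=> hc G0; have [ur cr mc] := hc.
transitivity (\int[mu]_(x in D)
    (\sum_(z <- r) (G z)%:E * (\1_(c @^-1` [set z]) x)%:E))%E.
  apply: eq_integral => x _.
  rewrite (bigD1_seq (c x))//= big1_seq ?adde0.
    by rewrite indicE mem_set ?mule1.
  move=> z /andP[zc _]; rewrite indicE memNset ?mule0//= => /esym/eqP.
  by rewrite (negbTE zc).
rewrite ge0_integral_sum//; last 2 first.
- move=> z; apply/measurable_EFinP/measurable_funM => //.
  by apply: measurable_indic; exact: mc.
- by move=> z x _; rewrite mule_ge0 ?lee_fin.
rewrite -sumEFin; apply: eq_bigr => z _.
rewrite ge0_integralZl_EFin//; last first.
  by apply/measurable_EFinP/measurable_indic; exact: mc.
rewrite integral_indic//=; last exact: mc.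
by rewrite setIC EFinM fineK ?fin_muI// muleC.
Qed.

(** The integral may be computed from any finite labelling [c], even if [F] identifies labels.
    Additivity then follows by labelling points with the pair of values. *)
Lemma simple_integral_comp (V : normedModType R[i]) (Z : eqType) (c : R -> Z)
    (r : seq Z) (F : Z -> V) : fsimple c r ->
  simple_integral D (F \o c) =
  \sum_(z <- r) (fine (mu (D `&` c @^-1` [set z])))%:C *: F z.
Proof.
move=> hc; have [ur cr mc] := hc.
rewrite /simple_integral (fsbig_fwiden (undup (map F r)))/=; last 3 first.
- by move=> _ [x _ <-] /=; rewrite mem_undup map_f.
- exact: undup_uniq.
- move=> v [/= _ vF]; rewrite (_ : _ `&` _ = set0).
    by rewrite measure0 scale0r.
  by apply/seteqP; split => // x [_ /= xv]; apply: vF; exists x.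
transitivity (\sum_(v <- undup (map F r)) \sum_(z <- r | F z == v)
    (fine (mu (D `&` c @^-1` [set z])))%:C *: F z).
  apply: eq_bigr => v _.
  rewrite (eq_bigr (fun z => (fine (mu (D `&` c @^-1` [set z])))%:C *: v));
    last by move=> z /eqP ->.
  rewrite -scaler_suml -rmorph_sum/=; congr (_%:C *: _).
  apply: EFin_inj; rewrite fineK ?fin_muI//; last first.
    exact: fsimple_preimage (fsimple_comp hc F) _.
  have := integral_fsimple hc (G := fun z => (F z == v)%:R) (fun=> ler0n _ _).
  rewrite (eq_bigr (fun z => if F z == v then
    fine (mu (D `&` c @^-1` [set z])) else 0)); last first.
    by move=> z _; case: ifPn => _; rewrite (mulr1, mulr0).
  rewrite -big_mkcond => <-.
  rewrite setIC -integral_indic//; last exact: fsimple_preimage (fsimple_comp hc F) _.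
  apply: eq_integral => x _; rewrite indicE.
  suff -> : (x \in (F \o c) @^-1` [set v]) = (F (c x) == v) by [].
  by apply/idP/eqP => [/set_mem//|?]; exact/mem_set.
rewrite (exchange_big_dep xpredT)//= [LHS]big_seq [RHS]big_seq.
apply: eq_bigr => z zr.
rewrite big_mkcond (bigD1_seq (F z)) ?undup_uniq ?mem_undup ?map_f//= eqxx.
by rewrite big1 ?addr0// => v; rewrite eq_sym => /negbTE ->.
Qed.

End integrals.
End finitely_valued.

Section simple_integrals.
Variable R : realType.
Local Notation mu := (@lebesgue_measure R).

Lemma simple_fun_comp2 (V W V' : normedModType R[i]) (F : V -> W -> V') s t :
  simple_fun s -> simple_fun t -> simple_fun (fun x => F (s x) (t x)).
Proof.
move=> /simple_funP[r hs] /simple_funP[q ht]; apply/simple_funP.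
by eexists; exact: (fsimple_comp (fsimple_pair hs ht) (fun z => F z.1 z.2)).
Qed.

Lemma simple_fun_comp1 (V W : normedModType R[i]) (F : V -> W) s :
  simple_fun s -> simple_fun (fun x => F (s x)).
Proof.
move=> /simple_funP[r hs]; apply/simple_funP.
by eexists; exact: (fsimple_comp hs F).
Qed.

Lemma simple_fun_if (V : normedModType R[i]) (E : set R) s t : measurable E ->
  simple_fun s -> simple_fun t ->
  simple_fun (fun x => if x \in E then s x else t x : V).
Proof.
move=> /fsimple_mem mE /simple_funP[r hs] /simple_funP[q ht]; apply/simple_funP.
eexists; exact: (fsimple_comp (fsimple_pair mE (fsimple_pair hs ht))
  (fun z => if z.1 then z.2.1 else z.2.2)).
Qed.

Lemma simple_fun_cst (V : normedModType R[i]) (v : V) : simple_fun (fun=> v).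
Proof.
apply/simple_funP; exists [:: v]; split => // [x|z]; first by rewrite inE.
have [->|vz] := eqVneq v z.
  by rewrite (_ : _ @^-1` _ = setT)//; apply/seteqP; split.
rewrite (_ : _ @^-1` _ = set0)//; apply/seteqP; split => // x /= vz'.
by rewrite vz' eqxx in vz.
Qed.

Section domain.
Variable D : set R.
Hypotheses (mD : measurable D) (finD : (mu D < +oo)%E).

Lemma simple_integralD (V : normedModType R[i]) (s t : R -> V) :
  simple_fun s -> simple_fun t ->
  simple_integral D (fun x => s x + t x) =
  simple_integral D s + simple_integral D t.
Proof.
move=> /simple_funP[r hs] /simple_funP[q ht].
have hst := fsimple_pair hs ht.
rewrite (simple_integral_comp mD finD (fun z => z.1 + z.2) hst).
rewrite [in RHS](simple_integral_comp mD finD fst hst).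
rewrite [X in _ = _ + X](simple_integral_comp mD finD snd hst).
by rewrite -big_split/=; apply: eq_bigr => z _; rewrite scalerDr.
Qed.

Lemma simple_integral_lin (V W : normedModType R[i]) (L : V -> W) (s : R -> V) :
  linear L -> simple_fun s ->
  simple_integral D (fun x => L (s x)) = L (simple_integral D s).
Proof.
move=> lL /simple_funP[r hs].
rewrite (simple_integral_comp mD finD L hs).
rewrite [in RHS](simple_integral_comp mD finD id hs) (lin_sum lL).
by apply: eq_bigr => z _; rewrite (linZ lL).
Qed.

Lemma rnorm_simple_integral (V : normedModType R[i]) (s : R -> V) :
  simple_fun s ->
  ((rnorm (simple_integral D s))%:E <= \int[mu]_(x in D) (rnorm (s x))%:E)%E.
Proof.
move=> /simple_funP[r hs].
rewrite (integral_fsimple mD finD (G := @rnorm R V) hs); last exact: rnorm_ge0.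
rewrite (simple_integral_comp mD finD id hs) lee_fin.
rewrite (le_trans (rnorm_sum _ _ _))//; apply: ler_sum => z _.
by rewrite rnormZr ger0_norm// fine_ge0.
Qed.

End domain.

Section strong_measurability.
Variable D : set R.
Hypotheses (mD : measurable D).

Lemma strongly_measurable_simple (V : normedModType R[i]) (s : R -> V) :
  simple_fun s -> strongly_measurable D s.
Proof. by move=> hs; exists (fun=> s) => // x _; exact: cvg_cst. Qed.

Lemma strongly_measurableD (V : normedModType R[i]) (f g : R -> V) :
  strongly_measurable D f -> strongly_measurable D g ->
  strongly_measurable D (fun x => f x + g x).
Proof.
move=> [s hs sf] [t ht tg]; exists (fun n x => s n x + t n x).
  by move=> n; exact: simple_fun_comp2.
by move=> x Dx; apply: cvgD; [exact: sf|exact: tg].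
Qed.

Lemma strongly_measurable_lin (V W : normedModType R[i]) (L : V -> W)
    (f : R -> V) : bounded_linear L ->
  strongly_measurable D f -> strongly_measurable D (fun x => L (f x)).
Proof.
move=> bL [s hs sf]; exists (fun n x => L (s n x)).
  by move=> n; exact: simple_fun_comp1.
by move=> x Dx; apply: bounded_linear_cvg => //; exact: sf.
Qed.

Lemma bounded_linearZ (V : normedModType R[i]) (c : R[i]) :
  bounded_linear (fun x : V => c *: x).
Proof.
split; first by move=> a x y; rewrite scalerDr !scalerA mulrC.
by exists (complex.Re `|c|) => x; rewrite rnormZ.
Qed.

Lemma strongly_measurableB (V : normedModType R[i]) (f g : R -> V) :
  strongly_measurable D f -> strongly_measurable D g ->
  strongly_measurable D (fun x => f x - g x).
Proof.
move=> hf /(strongly_measurable_lin (bounded_linearZ V (-1)))/(strongly_measurableD hf).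
by under eq_fun do rewrite scaleN1r.
Qed.

Lemma measurable_rnorm (V : normedModType R[i]) (f : R -> V) :
  strongly_measurable D f -> measurable_fun D (fun x => rnorm (f x)).
Proof.
move=> [s hs sf].
apply: (@measurable_fun_cvg _ _ _ _ (fun n x => rnorm (s n x))) => [n|x Dx].
  by have /simple_funP[r hr] := hs n; exact: (measurable_fsimple hr).
apply/cvgrPdist_lt => e e0; move/cvg_rnormP : (sf x Dx) => /(_ _ e0).
apply: filterS => n; apply: le_lt_trans.
rewrite ler_distl; have := rnormD (s n x - f x) (f x).
have := rnormD (f x - s n x) (s n x); rewrite !subrK rnorm_distC => h1 h2.
by apply/andP; split; lra.
Qed.

Lemma eq_strongly_measurable (V : normedModType R[i]) (f g : R -> V) :
  (forall x, D x -> f x = g x) ->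
  strongly_measurable D f -> strongly_measurable D g.
Proof.
by move=> fg [s hs sf]; exists s => // x Dx; rewrite -fg//; exact: sf.
Qed.

End strong_measurability.
End simple_integrals.

(** * The Bochner integral: uniqueness, linearity, closure under limits *)

Section bochner_integral.
Variable R : realType.
Local Notation mu := (@lebesgue_measure R).

Definition dist1 (V : normedModType R[i]) (D : set R) (f g : R -> V) : \bar R :=
  (\int[mu]_(x in D) (rnorm (f x - g x))%:E)%E.

Variable D : set R.
Hypotheses (mD : measurable D) (finD : (mu D < +oo)%E).

Lemma dist1_ge0 (V : normedModType R[i]) (f g : R -> V) : (0 <= dist1 D f g)%E.
Proof. by apply: integral_ge0 => x _; rewrite lee_fin rnorm_ge0. Qed.

Lemma le_integral_rnorm (V W V' : normedModType R[i]) (f : R -> V) (g : R -> W)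
    (h : R -> V') (a b : R) :
  0 <= a -> 0 <= b ->
  strongly_measurable D f -> strongly_measurable D g -> strongly_measurable D h ->
  (forall x, D x -> rnorm (f x) <= a * rnorm (g x) + b * rnorm (h x)) ->
  (\int[mu]_(x in D) (rnorm (f x))%:E <=
   a%:E * \int[mu]_(x in D) (rnorm (g x))%:E +
   b%:E * \int[mu]_(x in D) (rnorm (h x))%:E)%E.
Proof.
move=> a0 b0 mf mg mh fgh.
have mE (V0 : normedModType R[i]) (k : R -> V0) : strongly_measurable D k ->
    measurable_fun D (fun x => (rnorm (k x))%:E).
  by move=> mk; apply/measurable_EFinP; exact: measurable_rnorm.
have kE (V0 : normedModType R[i]) (k : R -> V0) x : D x -> (0 <= (rnorm (k x))%:E)%E.
  by move=> _; rewrite lee_fin rnorm_ge0.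
rewrite -!ge0_integralZl_EFin//; try exact: mE; try exact: kE.
rewrite -ge0_integralD//.
- apply: ge0_le_integral => //; first by move=> x _; rewrite lee_fin rnorm_ge0.
  + exact: mE.
  + by apply: emeasurable_funD; apply: measurable_funeM; exact: mE.
- by move=> x _; rewrite mule_ge0// lee_fin ?rnorm_ge0.
- by apply: measurable_funeM; exact: mE.
- by move=> x _; rewrite mule_ge0// lee_fin ?rnorm_ge0.
- by apply: measurable_funeM; exact: mE.
Qed.

Lemma dist1_triangle (V : normedModType R[i]) (f g h : R -> V) :
  strongly_measurable D f -> strongly_measurable D g -> strongly_measurable D h ->
  (dist1 D f h <= dist1 D f g + dist1 D g h)%E.
Proof.
move=> mf mg mh.
have := @le_integral_rnorm _ _ _ (fun x => f x - h x) (fun x => f x - g x)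
  (fun x => g x - h x) 1 1.
rewrite !mul1e; apply => //; try exact: strongly_measurableB.
by move=> x Dx; rewrite !mul1r rnorm_distD.
Qed.

(** Trades the approximating sequence for one simple function per tolerance; conversely the sequence
    is rebuilt from the tolerances [n.+1%:R^-1]. *)
Lemma is_bochner_integralP (V : completeNormedModType R[i]) (f : R -> V) (v : V) :
  is_bochner_integral D f v <-> strongly_measurable D f /\
  forall e : R, 0 < e -> exists s, [/\ simple_fun s, (dist1 D f s <= e%:E)%E &
    rnorm (simple_integral D s - v) <= e].
Proof.
split=> [[mf [s [hs sf sv]]]|[mf h]]; split => //.
  move=> e e0; move/fine_cvgP : sf => [+ /cvgrPdist_lt/(_ e e0)].
  move/cvg_rnormP : sv => /(_ e e0) h1 h2 h3.
  near \oo => n; exists (s n); split => //; last by apply: ltW; near: n.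
  have h4 : (dist1 D f (s n)) \is a fin_num by near: n.
  rewrite -(fineK h4) lee_fin.
  have : `|0 - fine (dist1 D f (s n))| < e by near: n.
  by rewrite sub0r normrN => /ltW; apply: le_trans; exact: ler_norm.
have /choice[s hs] (n : nat) : exists s, [/\ simple_fun s,
    (dist1 D f s <= n.+1%:R^-1%:E)%E &
    rnorm (simple_integral D s - v) <= n.+1%:R^-1].
  by apply: h; rewrite invr_gt0.
exists s; split => [n||].
- by have [] := hs n.
- apply: (@squeeze_cvge _ _ _ _ (cst 0%E) _ (fun n => n.+1%:R^-1%:E)).
  + by near=> n; have [_ + _] := hs n; rewrite dist1_ge0/=.
  + exact: cvg_cst.
  + by apply: cvg_EFin; [exact: nearW|exact: cvg_harmonic].
- apply/cvg_rnormP => e e0.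
  have /cvgrPdist_lt/(_ e e0) := @cvg_harmonic R.
  apply: filterS => n; rewrite sub0r normrN gtr0_norm ?invr_gt0//.
  by apply: le_lt_trans; have [_ _] := hs n.
Unshelve. all: by end_near. Qed.

Variable V : completeNormedModType R[i].
Implicit Types f g : R -> V.

Lemma strongly_measurable_bochner f v :
  is_bochner_integral D f v -> strongly_measurable D f.
Proof. by case. Qed.

Lemma is_bochner_integral_simple (s : R -> V) :
  simple_fun s -> is_bochner_integral D s (simple_integral D s).
Proof.
move=> hs; apply/is_bochner_integralP; split.
  exact: strongly_measurable_simple.
move=> e e0; exists s; rewrite subrr rnorm0 (ltW e0); split => //.
rewrite /dist1 (eq_integral (cst 0%E)) ?integral0 ?lee_fin ?ltW// => x _.
by rewrite subrr rnorm0.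
Qed.

Lemma is_bochner_integralD f g v w : is_bochner_integral D f v ->
  is_bochner_integral D g w ->
  is_bochner_integral D (fun x => f x + g x) (v + w).
Proof.
move=> /is_bochner_integralP[mf hf] /is_bochner_integralP[mg hg].
apply/is_bochner_integralP; split; first exact: strongly_measurableD.
move=> e e0; have e2 : 0 < e / 2 by rewrite divr_gt0.
have [s [hs fs sv]] := hf _ e2; have [t [ht gt tw]] := hg _ e2.
exists (fun x => s x + t x); split; first exact: simple_fun_comp2.
  have := @le_integral_rnorm _ _ _ (fun x => (f x + g x) - (s x + t x))
    (fun x => f x - s x) (fun x => g x - t x) 1 1.
  rewrite !mul1e => h; rewrite (splitr e) EFinD; apply: le_trans (leeD fs gt).
  have ms := strongly_measurable_simple D hs.
  have mt := strongly_measurable_simple D ht.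
  apply: h => //; try by do ?[apply: strongly_measurableB|apply: strongly_measurableD].
  by move=> x _; rewrite !mul1r opprD addrACA rnormD.
rewrite simple_integralD// opprD addrACA (splitr e).
by rewrite (le_trans (rnormD _ _))// lerD.
Qed.

Lemma is_bochner_integral_lin (W : completeNormedModType R[i]) (L : V -> W) f v :
  bounded_linear L -> is_bochner_integral D f v ->
  is_bochner_integral D (fun x => L (f x)) (L v).
Proof.
move=> bL /is_bochner_integralP[mf hf].
have lL := bL.1; have [M M0 hM] := bounded_linear_gt0 bL.
apply/is_bochner_integralP; split; first exact: strongly_measurable_lin.
move=> e e0; have e2 : 0 < e / M by rewrite divr_gt0.
have [s [hs fs sv]] := hf _ e2.
have ms := strongly_measurable_simple D hs.
exists (fun x => L (s x)); split; first exact: simple_fun_comp1.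
  have := @le_integral_rnorm _ _ _ (fun x => L (f x) - L (s x))
    (fun x => f x - s x) (fun x => f x - s x) M 0.
  rewrite mul0e adde0 => h; apply: le_trans.
    apply: h => //; try exact: ltW.
    - by apply: strongly_measurableB; apply: strongly_measurable_lin.
    - exact: strongly_measurableB.
    - exact: strongly_measurableB.
    - by move=> x _; rewrite mul0r addr0 -(linB lL).
  apply: le_trans (lee_wpmul2l _ fs) _; first by rewrite lee_fin ltW.
  by rewrite -EFinM lee_fin mulrC divfK// gt_eqF.
rewrite simple_integral_lin// -(linB lL) (le_trans (hM _))//.
by rewrite -ler_pdivlMl// mulrC.
Qed.

Lemma is_bochner_integralB f g v w : is_bochner_integral D f v ->
  is_bochner_integral D g w ->
  is_bochner_integral D (fun x => f x - g x) (v - w).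
Proof.
move=> hf /(is_bochner_integral_lin (bounded_linearZ V (-1))).
move=> /(is_bochner_integralD hf); rewrite scaleN1r.
by under eq_fun do rewrite scaleN1r.
Qed.

Lemma rnorm_bochner_le f v : is_bochner_integral D f v ->
  ((rnorm v)%:E <= \int[mu]_(x in D) (rnorm (f x))%:E)%E.
Proof.
move=> /is_bochner_integralP[mf hf]; apply/lee_addgt0Pr => e e0.
have e2 : 0 < e / 2 by rewrite divr_gt0.
have [s [hs fs sv]] := hf _ e2.
have ms := strongly_measurable_simple D hs.
have h1 : (\int[mu]_(x in D) (rnorm (s x))%:E <=
    \int[mu]_(x in D) (rnorm (f x))%:E + (e / 2)%:E)%E.
  have := @le_integral_rnorm _ _ _ s f (fun x => f x - s x) 1 1.
  rewrite !mul1e => h; apply: le_trans (leeD2l _ fs).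
  apply: h => //; first exact: strongly_measurableB.
  move=> x _; rewrite !mul1r rnorm_distC.
  by have := rnormD (f x) (s x - f x); rewrite addrC subrK.
apply: (@le_trans _ _ ((rnorm (simple_integral D s))%:E + (e / 2)%:E)%E).
  rewrite -EFinD lee_fin.
  have := rnormB (simple_integral D s) (simple_integral D s - v).
  by rewrite opprB addrC subrK; lra.
rewrite [in leRHS](splitr e) EFinD addeA leeD2r//.
by apply: le_trans h1; exact: rnorm_simple_integral.
Qed.

Lemma is_bochner_integral_unique f v w :
  is_bochner_integral D f v -> is_bochner_integral D f w -> v = w.
Proof.
move=> hv hw; have := rnorm_bochner_le (is_bochner_integralB hv hw).
rewrite (eq_integral (cst 0%E)) ?integral0 ?lee_fin; last first.
  by move=> x _; rewrite subrr rnorm0.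
move=> h; apply/eqP; rewrite -subr_eq0 -rnorm_eq0.
by rewrite eq_le h rnorm_ge0.
Qed.

(** The approximants are themselves Bochner integrals. This serves to change an integrand on a null
    set, and to pass from step inputs to square integrable ones. *)
Lemma is_bochner_integral_lim f v : strongly_measurable D f ->
  (forall e : R, 0 < e -> exists g w, [/\ is_bochner_integral D g w,
    (dist1 D f g <= e%:E)%E & rnorm (w - v) <= e]) ->
  is_bochner_integral D f v.
Proof.
move=> mf h; apply/is_bochner_integralP; split=> // e e0.
have e2 : 0 < e / 2 by rewrite divr_gt0.
have [g [w [/is_bochner_integralP[mg hg] fg wv]]] := h _ e2.
have [s [hs gs sw]] := hg _ e2; exists s; split => //.
  rewrite (splitr e) EFinD; apply: le_trans (leeD fg gs).
  by apply: dist1_triangle => //; exact: strongly_measurable_simple.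
by rewrite (le_trans (rnorm_distD w _ _))// (splitr e) lerD.
Qed.

Lemma eq_is_bochner_integral f g v : (forall x, D x -> f x = g x) ->
  is_bochner_integral D f v -> is_bochner_integral D g v.
Proof.
move=> fg hf; have mf := strongly_measurable_bochner hf.
apply: is_bochner_integral_lim; first exact: eq_strongly_measurable mf.
move=> e e0; exists f, v; rewrite subrr rnorm0 (ltW e0); split => //.
rewrite /dist1 (eq_integral (cst 0%E)) ?integral0 ?lee_fin ?ltW//.
by move=> x /set_mem Dx; rewrite fg// subrr rnorm0.
Qed.

Lemma is_bochner_integral0 : is_bochner_integral D (fun=> 0 : V) 0.
Proof.
have := is_bochner_integral_simple (simple_fun_cst (0 : V)).
move=> /(is_bochner_integral_lin (bounded_linearZ V 0)).
by rewrite !scale0r.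
Qed.

Lemma is_bochner_integral_sum (I : Type) (r : seq I) (f : I -> R -> V) (v : I -> V) :
  (forall i, is_bochner_integral D (f i) (v i)) ->
  is_bochner_integral D (fun x => \sum_(i <- r) f i x) (\sum_(i <- r) v i).
Proof.
move=> h; elim: r => [|i r IH].
  by rewrite big_nil; under eq_fun do rewrite big_nil; exact: is_bochner_integral0.
by rewrite big_cons; under eq_fun do rewrite big_cons; exact: is_bochner_integralD.
Qed.

End bochner_integral.

(** * Translation invariance of the Lebesgue and Bochner integrals *)

Section translation.
Variable R : realType.
Local Notation mu := (@lebesgue_measure R).

Let measurable_translation (a : R) : measurable_fun setT (fun x : R => x - a).
Proof. exact: measurable_funB. Qed.

Let mt (a : R) : @measurable_fun _ _ (measurableTypeR R) (measurableTypeR R)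
  setT (fun x => x - a) := measurable_translation a.

Let translated (a : R) :=
  @measure_function_pushforward__canonical__measure_function_Measure
  _ _ _ _ _ mu _ (mt a).

(** The image measure under the translation gives half-open intervals their length, and Lebesgue
    measure is determined by these. *)
Lemma lebesgue_measure_translation (a : R) (A : set R) : measurable A ->
  mu ((fun x => x - a) @^-1` A) = mu A.
Proof.
move=> mA; apply/esym.
apply: (@lebesgue_measure_unique _ (translated a) _ _ mA) => _ [[x y] _ <-].
rewrite /= /pushforward (_ : _ @^-1` _ = `]x + a, y + a]%classic).
  by rewrite !lebesgue_measure_itv/= !lte_fin ltrD2r -!EFinB (addrC x) addrKA.
by apply/seteqP; split => z /=; rewrite !in_itv/= ltrBrDr lerBlDr.
Qed.

Lemma ge0_integral_translation (D D' : set R) (a : R) (f g : R -> \bar R) :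
  measurable D -> measurable_fun D f -> (forall x, D x -> 0 <= f x)%E ->
  (forall x, D x -> D' (x + a)) ->
  (forall x, D' x -> g x = if x - a \in D then f (x - a) else 0%E) ->
  (\int[mu]_(x in D') g x = \int[mu]_(x in D) f x)%E.
Proof.
move=> mD mf f0 DD' gE.
transitivity (\int[translated a]_(x in D) f x)%E; last first.
  by apply: eq_measure_integral => A mA _; exact: lebesgue_measure_translation.
rewrite [RHS](ge0_integral_pushforward (mt a) _ mD mf); last first.
  by move=> x /set_mem; exact: f0.
rewrite [LHS]integral_mkcond [RHS]integral_mkcond.
apply: eq_integral => x _.
rewrite /patch.
have -> : (x \in (fun y : R => y - a) @^-1` D) = (x - a \in D).
  by apply/idP/idP => /set_mem h; exact/mem_set.
case: ifPn => [/set_mem/gE //|/negP xD'].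
by rewrite ifF//; apply/negP => /set_mem/DD'; rewrite subrK => /mem_set.
Qed.

Lemma is_bochner_integral_translation (V : completeNormedModType R[i])
    (D D' : set R) (a : R) (f : R -> V) (v : V) :
  measurable D -> (mu D < +oo)%E -> measurable D' -> (mu D' < +oo)%E ->
  (forall x, D x -> D' (x + a)) ->
  is_bochner_integral D f v ->
  is_bochner_integral D' (fun x => if x - a \in D then f (x - a) else 0) v.
Proof.
move=> mD finD mD' finD' DD' /is_bochner_integralP[mf hf].
have mDa : measurable ((fun x => x - a) @^-1` D).
  by rewrite -[_ @^-1` _]setTI; exact: measurable_translation.
have memE x : (x \in (fun y : R => y - a) @^-1` D) = (x - a \in D).
  by apply/idP/idP => /set_mem h; exact/mem_set.
pose ext (s : R -> V) x := if x - a \in D then s (x - a) else 0.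
have simple_ext s : simple_fun s -> simple_fun (ext s).
  move=> /simple_funP[r hs].
  have hs' : simple_fun (fun x => s (x - a)).
    by apply/simple_funP; exists r; exact: fsimple_shift.
  have := simple_fun_if mDa hs' (simple_fun_cst (0 : V)).
  by congr simple_fun; apply/funext => x; rewrite /ext memE.
apply/is_bochner_integralP => //; split.
  have [s hs sf] := mf; exists (fun n => ext (s n)).
    by move=> n; exact: simple_ext.
  move=> x D'x; rewrite /ext; case: ifPn => [/set_mem xD|_]; first exact: sf.
  exact: cvg_cst.
move=> e e0; have [s [hs fs sv]] := hf _ e0; exists (ext s); split => //.
- exact: simple_ext.
- rewrite /dist1 (@ge0_integral_translation D D' a (fun x => (rnorm (f x - s x))%:E))//.
  + apply/measurable_EFinP; apply: measurable_rnorm => //.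
    by apply: strongly_measurableB => //; exact: strongly_measurable_simple.
  + by move=> x _; rewrite lee_fin rnorm_ge0.
  + by move=> x D'x; rewrite /ext; case: ifPn => //; rewrite subrr rnorm0.
- suff -> : simple_integral D' (ext s) = simple_integral D s by [].
  have /simple_funP[r hr] := hs; have [ur sr ms] := hr.
  (* The label [None] separates the points outside the translate of [D] from those where [s] itself
     vanishes, so the other level sets are exact translates. *)
  pose c x := if x - a \in D then Some (s (x - a)) else None.
  have hc : fsimple c (None :: map Some r).
    split => [|x|z].
    + rewrite /= map_inj_uniq ?ur ?andbT; last by move=> ? ? [].
      by apply/mapP => -[].
    + rewrite /c; case: ifP => _; rewrite inE//= map_f//.
    + have hm := fsimple_mem mDa; have hsa := fsimple_shift hr a.
      have [_ _ /(_ z)] := fsimple_comp (fsimple_pair hm hsa)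
        (fun p => if p.1 then Some p.2 else None).
      suff -> : c = (fun p => if p.1 then Some p.2 else None) \o
        (fun x => (x \in (fun y => y - a) @^-1` D, s (x - a))) by [].
      by apply/funext => x; rewrite /= memE.
  have -> : ext s = odflt 0 \o c.
    by apply/funext => x; rewrite /= /ext /c; case: ifP.
  rewrite (simple_integral_comp mD' finD' _ hc).
  rewrite (simple_integral_comp mD finD id hr).
  rewrite big_cons scaler0 add0r big_map; apply: eq_bigr => z _ /=.
  congr ((fine _)%:C *: _); rewrite -[RHS](lebesgue_measure_translation a); last first.
    by apply: measurableI => //; exact: ms.
  congr (mu _); apply/seteqP; split => x /=; rewrite /c.
    by move=> [_]; case: ifPn => // /set_mem xD [].
  move=> [xD <-]; split; first by have := DD' _ xD; rewrite subrK.
  by rewrite mem_set.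
Qed.

End translation.

(** * Approximation by step functions *)

Section square_integrable.
Variables (R : realType) (V : normedModType R[i]) (t0 : R).
Local Notation mu := (@lebesgue_measure R).
Local Notation D := (`]0, t0[%classic : set R).

(** The square of the L^2 norm. *)
Definition norm2 (f : R -> V) : \bar R :=
  (\int[mu]_(x in D) (rnorm (f x) ^+ 2)%:E)%E.

Lemma measure_itv0 : (mu D < +oo)%E.
Proof. by rewrite lebesgue_measure_itv/=; case: ifP => _; rewrite ltry. Qed.

Lemma measurable_rnorm2 (f : R -> V) : strongly_measurable D f ->
  measurable_fun D (fun x => (rnorm (f x) ^+ 2)%:E).
Proof.
move=> mf; apply/measurable_EFinP; apply: measurable_funX.
exact: measurable_rnorm.
Qed.

Lemma le_norm2 (f g h : R -> V) (a b : R) : 0 <= a -> 0 <= b ->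
  strongly_measurable D f -> strongly_measurable D g -> strongly_measurable D h ->
  (forall x, D x -> rnorm (f x) ^+ 2 <=
     a * rnorm (g x) ^+ 2 + b * rnorm (h x) ^+ 2) ->
  (norm2 f <= a%:E * norm2 g + b%:E * norm2 h)%E.
Proof.
move=> a0 b0 mf mg mh fgh; rewrite /norm2.
have kE (k : R -> V) x : D x -> (0 <= (rnorm (k x) ^+ 2)%:E)%E.
  by move=> _; rewrite lee_fin sqr_ge0.
rewrite -!ge0_integralZl_EFin//; try exact: measurable_rnorm2; try exact: kE.
rewrite -ge0_integralD//.
- apply: ge0_le_integral => //; first by move=> x _; rewrite lee_fin sqr_ge0.
  + exact: measurable_rnorm2.
  + by apply: emeasurable_funD; apply: measurable_funeM; exact: measurable_rnorm2.
- by move=> x _; rewrite mule_ge0// lee_fin ?sqr_ge0.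
- by apply: measurable_funeM; exact: measurable_rnorm2.
- by move=> x _; rewrite mule_ge0// lee_fin ?sqr_ge0.
- by apply: measurable_funeM; exact: measurable_rnorm2.
Qed.

Lemma finite_norm2P (u : R -> V) :
  finite_norm mu 2%:E (fun s => rnorm (u s) * \1_D s) <-> (norm2 u < +oo)%E.
Proof.
have e : norm2 u = (\int[mu]_x `|(EFin \o (fun s => (rnorm (u s) * \1_D s)%R)) x| `^ 2)%E.
  rewrite /norm2 integral_mkcond; apply: eq_integral => x _.
  rewrite /patch /= indicE; case: ifP => _ /=.
    by rewrite mulr1 ger0_norm ?rnorm_ge0// powR_mulrn// rnorm_ge0.
  by rewrite mulr0 normr0 powR0.
rewrite /finite_norm unlock -e; split; last exact: poweR_lty.
by apply: lty_poweRy; rewrite invr_neq0.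
Qed.

Lemma LpB_pinfty_bounded (u : R -> V) (C : R) : strongly_measurable D u ->
  (forall x, D x -> rnorm (u x) <= C) -> LpB +oo%E D u.
Proof.
move=> mu0 uC; split => //; rewrite /finite_norm unlock.
case: ifP => _; last by rewrite ltry.
apply: le_lt_trans (ltry `|C|); apply/ess_supP/nearW => x /=.
rewrite lee_fin indicE; have [/set_mem Dx|_] := boolP (x \in D); last first.
  by rewrite mulr0 normr0.
by rewrite mulr1 ger0_norm ?rnorm_ge0// (le_trans (uC _ Dx))// ler_norm.
Qed.

Lemma LpB_pinfty_sub2 (u : R -> V) : LpB +oo%E D u -> LpB 2%:E D u.
Proof.
move=> [mf]; rewrite /finite_norm unlock.
(* The norm of exponent [+oo] is an essential supremum only when the whole space has positive
   measure. *)
have muT : (0 < mu setT)%E.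
  have : (mu `]0%R, 1%R[%classic <= mu setT)%E by apply: le_measure; rewrite ?inE.
  by apply: lt_le_trans; rewrite lebesgue_measure_itv/= lte_fin ltr01 sube0.
rewrite muT => uoo.
split => //; apply/finite_norm2P.
have [C hC] : exists C : R, \forall x \ae mu, D x -> rnorm (u x) <= C.
  pose f x := (rnorm (u x) * \1_D x)%R.
  have [C hC] : exists C : R, (ess_sup mu (abse \o (EFin \o f)) <= C%:E)%E.
    move: uoo; rewrite -/f; case: (ess_sup _ _) => [r _|//|_]; first by exists r.
    by exists 0; rewrite leNye.
  exists C; move/ess_supP : hC; apply: filterS => x /= + Dx.
  by rewrite /f indicE mem_set// mulr1 lee_fin ger0_norm ?rnorm_ge0.
apply: (@le_lt_trans _ _ (\int[mu]_(x in D) (C ^+ 2)%:E)%E).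
  apply: ae_ge0_le_integral => //.
  - by move=> x _; rewrite lee_fin sqr_ge0.
  - exact: measurable_rnorm2.
  - by move=> x _; rewrite lee_fin sqr_ge0.
  - apply: (@filterS _ _ (ae_filter_ringOfSetsType mu)) hC => x h Dx.
    rewrite lee_fin lerXn2r ?nnegrE ?rnorm_ge0 ?h//.
    exact: le_trans (rnorm_ge0 (u x)) (h Dx).
by rewrite integral_cst//= lte_mul_pinfty ?lee_fin ?sqr_ge0// measure_itv0.
Qed.

(** Pointwise approximants [v n] need not be dominated. Replacing them by 0 where their norm exceeds
    2 |u| keeps the convergence and bounds the error by 3 |u|, so dominated convergence applies with
    9 |u|^2. *)
Lemma norm2_simple_approx (u : R -> V) (e : R) : 0 < e ->
  strongly_measurable D u -> (norm2 u < +oo)%E ->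
  exists2 w, simple_fun w & (norm2 (fun x => u x - w x)%R <= e%:E)%E.
Proof.
move=> e0 mu0 u2; have [v hv vu] := mu0.
have mv n : measurable_fun D (fun x => rnorm (v n x)).
  by apply: measurable_rnorm => //; exact: strongly_measurable_simple.
pose E n := D `&` [set x | rnorm (v n x) <= 2 * rnorm (u x)].
have mE n : measurable (E n).
  apply: measurable_fun_le => //; apply: measurable_funM => //.
  exact: measurable_rnorm.
pose w n x := if x \in E n then v n x else 0.
have hw n : simple_fun (w n) by apply: simple_fun_if => //; exact: simple_fun_cst.
have : norm2 (fun x => u x - w n x) @[n --> \oo] --> (\int[mu]_(x in D) 0)%E.
  apply: (@dominated_cvg _ _ _ mu D _ _ _
    (fun x => 9%:E * (rnorm (u x) ^+ 2)%:E)%E) => //.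
  - move=> n; apply: measurable_rnorm2; apply: strongly_measurableB => //.
    exact: strongly_measurable_simple.
  - move=> x Dx; apply: cvg_EFin; first exact: nearW.
    have wu : w n x @[n --> \oo] --> u x.
      apply/cvg_rnormP => d d0; have := vu x Dx => /cvg_rnormP vux.
      have [ux0|ux0] := eqVneq (u x) 0.
        near=> n; rewrite /w; case: ifPn => [/set_mem[_ /=]|_].
          rewrite ux0 rnorm0 mulr0 subr0 => h; exact: le_lt_trans h d0.
        by rewrite ux0 subrr rnorm0.
      have r0 : 0 < rnorm (u x) by rewrite lt0r rnorm_eq0 ux0 rnorm_ge0.
      near=> n; rewrite /w ifT; first by near: n; exact: vux.
      apply/mem_set; split => //=.
      have : rnorm (v n x - u x) < rnorm (u x) by near: n; exact: vux.
      by have := rnormD (v n x - u x) (u x); rewrite subrK; lra.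
    apply/cvgrPdist_lt => d d0; move/cvg_rnormP : wu => /(_ (Num.min 1 d)).
    rewrite lt_min ltr01 d0 => /(_ isT); apply: filterS => n /=.
    rewrite lt_min => /andP[h1 h2]; rewrite sub0r normrN ger0_norm ?sqr_ge0//.
    rewrite rnorm_distC; apply: le_lt_trans h2.
    by rewrite expr2 ler_piMl ?rnorm_ge0// ltW.
  - apply: integrableZl => //; apply/integrableP; split; first exact: measurable_rnorm2.
    by under eq_integral do rewrite gee0_abs ?lee_fin ?sqr_ge0//.
  - move=> n x Dx; rewrite gee0_abs ?lee_fin ?sqr_ge0//.
    have : rnorm (u x - w n x) <= 3 * rnorm (u x).
      rewrite (le_trans (rnormB _ _))// /w; case: ifPn => [/set_mem[_ /=]|_]; first lra.
      by rewrite rnorm0; have := rnorm_ge0 (u x); lra.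
    by have := rnorm_ge0 (u x); have := rnorm_ge0 (u x - w n x); nra.
rewrite integral0 => /fine_cvgP[h1 /cvgrPdist_lt/(_ e e0) h2].
near \oo => n; exists (w n) => //.
have h3 : norm2 (fun x => u x - w n x) \is a fin_num by near: n.
rewrite -(fineK h3) lee_fin; apply: ltW.
have : `|0 - fine (norm2 (fun x => u x - w n x))| < e by near: n.
by rewrite sub0r normrN; apply: le_lt_trans; exact: ler_norm.
Unshelve. all: by end_near. Qed.

End square_integrable.

Lemma natr_dist_lt1 (K : realDomainType) (m n : nat) :
  `|m%:R - n%:R : K| < 1 -> m = n.
Proof.
move=> mn; have [lt|lt|//] := ltngtP m n.
  move: mn; rewrite distrC -natrB ?(ltnW lt)// normr_nat -[1]/(1%:R) ltr_nat.
  by rewrite ltnS leqn0 subn_eq0 leqNgt lt.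
move: mn; rewrite -natrB ?(ltnW lt)// normr_nat -[1]/(1%:R) ltr_nat.
by rewrite ltnS leqn0 subn_eq0 leqNgt lt.
Qed.

(** * Regular grids and density of step functions in L^2 *)

Section cells.
Variables (R : realType) (t0 : R).
Hypothesis t0_gt0 : 0 < t0.
Local Notation mu := (@lebesgue_measure R).
Local Notation D := (`]0, t0[%classic : set R).

(* Cells of the regular grid of mesh [t0 / N]; the value off [D] is junk. *)
Definition cell (N : nat) (s : R) : nat :=
  if s \in D then Num.truncn (s / (t0 / N%:R)) else 0%N.

Section mesh.
Variable N : nat.
Hypothesis N0 : (0 < N)%N.
Let h := t0 / N%:R.

Lemma mesh_gt0 : 0 < h.
Proof. by rewrite divr_gt0// ltr0n. Qed.

Lemma mulr_mesh : N%:R * h = t0.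
Proof. by rewrite /h mulrC divfK// pnatr_eq0 -lt0n. Qed.

Lemma cell_eq s k : 0 < s < t0 ->
  (cell N s == k) = (k%:R * h <= s < k.+1%:R * h).
Proof.
move=> st; rewrite /cell mem_set/= ?in_itv//.
move/andP : st => [s0 st].
rewrite -/h truncn_eq; last by rewrite divr_ge0// ltW// mesh_gt0.
by rewrite ler_pdivlMr ?mesh_gt0// ltr_pdivrMr ?mesh_gt0.
Qed.

Lemma cell_itv s : 0 < s < t0 -> (cell N s)%:R * h <= s < (cell N s).+1%:R * h.
Proof. by move=> st; rewrite -cell_eq. Qed.

Lemma cell_lt s : (cell N s < N)%N.
Proof.
have [/set_mem/= st|st] := boolP (s \in D); last by rewrite /cell (negbTE st).
move: st; rewrite in_itv/= => st; have /andP[h1 _] := cell_itv st.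
rewrite -(ltr_nat R) -(ltr_pM2r mesh_gt0) (le_lt_trans h1)// mulr_mesh.
by case/andP : st.
Qed.

Lemma fsimple_cell : fsimple (cell N) (iota 0 N).
Proof.
split => [|s|k]; first exact: iota_uniq.
  by rewrite mem_iota add0n leq0n cell_lt.
rewrite (_ : _ @^-1` _ = (D `&` `[k%:R * h, k.+1%:R * h[%classic) `|`
    (if k == 0%N then ~` D else set0)).
  apply: measurableU; first exact: measurableI.
  by case: ifP => // _; exact: measurableC.
apply/seteqP; split => s /=.
  have [/set_mem/= st|st] := boolP (s \in D).
    move=> /eqP; move: st; rewrite in_itv/= => st; rewrite cell_eq// => sk.
    by left; split; rewrite ?in_itv.
  rewrite /cell (negbTE st) => <-; right => /=; move: st.
  by move=> /negP h1 h2; apply: h1; exact: mem_set.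
move=> [[st sk]|]; first by apply/eqP; rewrite cell_eq; rewrite in_itv/= in st sk.
case: eqP => // -> st; rewrite /cell ifF//; apply/negP => /set_mem; exact: st.
Qed.

(** Each cell contains its interior, an open interval of length [h]; this direction turns L^2
    smallness into smallness of a sum over the grid. *)
Lemma integral_cell (G : nat -> R) : (forall k, 0 <= G k) ->
  ((h * \sum_(k < N) G k)%:E <= \int[mu]_(s in D) (G (cell N s))%:E)%E.
Proof.
move=> G0; rewrite (integral_fsimple _ (measure_itv0 _) fsimple_cell)// lee_fin.
rewrite -[X in iota 0 X](subn0 N) -/(index_iota 0 N) big_mkord mulr_sumr.
apply: ler_sum => k _; apply: ler_wpM2r => //.
rewrite -lee_fin fineK; last first.
  by apply: fin_muI => //; [exact: measure_itv0|case: fsimple_cell].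
have kh : k%:R * h < k.+1%:R * h by rewrite ltr_pM2r ?mesh_gt0// ltr_nat.
have muk : mu `]k%:R * h, k.+1%:R * h[%classic = h%:E.
  rewrite lebesgue_measure_itv/= lte_fin kh -EFinB -natr1 mulrDl mul1r.
  by rewrite addrAC subrr add0r.
rewrite -muk; apply: le_measure; rewrite ?inE//.
  by apply: measurableI => //; have [_ _] := fsimple_cell; exact.
move=> s /=; rewrite in_itv/= => /andP[h1 h2].
have st : 0 < s < t0.
  rewrite (le_lt_trans (mulr_ge0 (ler0n _ k) (ltW mesh_gt0)) h1)/=.
  by rewrite (lt_le_trans h2)// -[leRHS]mulr_mesh ler_pM2r ?mesh_gt0// ler_nat.
by split; [rewrite in_itv|apply/eqP; rewrite cell_eq// (ltW h1)].
Qed.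

End mesh.

(** Two grids have a common refinement, so the difference of two step functions is again a step
    function on one regular grid. *)
Lemma cell_refine (N p : nat) s : (0 < N)%N -> (0 < p)%N ->
  cell N s = (cell (N * p) s %/ p)%N.
Proof.
move=> N0 p0; have Np0 : (0 < N * p)%N by rewrite muln_gt0 N0.
have [/set_mem/= st|st] := boolP (s \in D); last by rewrite /cell (negbTE st) div0n.
rewrite in_itv/= in st; apply/eqP; rewrite cell_eq//.
have /andP[] := cell_itv Np0 st; set q := cell _ _.
have p0' : 0 < p%:R :> R by rewrite ltr0n.
have N0' : 0 < N%:R :> R by rewrite ltr0n.
have e (k : nat) : k%:R * (t0 / N%:R) = (k * p)%:R * (t0 / (N * p)%:R).
  by rewrite !natrM; field; rewrite !gt_eqF.
rewrite !e => q1 q2; rewrite (le_trans _ q1)/=; last first.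
  by rewrite ler_pM2r ?mesh_gt0// ler_nat leq_trunc_div.
rewrite (lt_le_trans q2)// ler_pM2r ?mesh_gt0// ler_nat.
exact: ltn_ceil.
Qed.

Lemma simple_cell (V : normedModType R[i]) (N : nat) (a : nat -> V) : (0 < N)%N ->
  simple_fun (fun s => a (cell N s)).
Proof.
move=> N0; apply/simple_funP; eexists.
exact: (fsimple_comp (fsimple_cell N0) a).
Qed.

(* Lusin's theorem: off a small set, a simple function is locally constant, so
   it is constant on the intersection of a compact set with each fine cell. *)
Lemma simple_cell_approx (V : normedModType R[i]) (w : R -> V) (e : R) : 0 < e ->
  simple_fun w -> exists N (a : nat -> V), (0 < N)%N /\
    (norm2 t0 (fun s => w s - a (cell N s))%R <= e%:E)%E.
Proof.
move=> e0 hw; have /simple_funP[r hr] := hw; have [ur wr mw] := hr.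
pose m := \sum_(v <- r) rnorm v.
have m0 : 0 <= m by apply: sumr_ge0 => v _; exact: rnorm_ge0.
have wm s : rnorm (w s) <= m.
  rewrite /m (bigD1_seq (w s))//= lerDl.
  by apply: sumr_ge0 => v _; exact: rnorm_ge0.
(* The error is at most 2 m on the exceptional set, whose measure will be below [d]; the [+ 1]
   covers m = 0. *)
pose d := e / (4 * m ^+ 2 + 1).
have m1 : 0 < 4 * m ^+ 2 + 1 by have := sqr_ge0 m; lra.
have d0 : 0 < d by rewrite divr_gt0.
(* The values of [w] are coded by integers so that Lusin's theorem for real functions applies: codes
   at distance less than 1 are equal. *)
pose f s : R := (index (w s) r)%:R.
have mf : measurable_fun D f.
  exact: (measurable_fsimple hr (fun v => (index v r)%:R)).
have [K [cK KD muK fK]] := measurable_almost_continuous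
  (measurable_itv _ : measurable D) (measure_itv0 t0) d0 mf.
have mK : measurable K by exact: compact_measurable.
(* Compactness of [K] makes local constancy uniform: one mesh works at every point of [K]. *)
have near_const : \forall N \near \oo, K `<=`
    [set s | forall s', K s' -> `|s - s'| < t0 / N.+1%:R -> w s' = w s].
  have cov := (near_covering_withinP K).2 ((compact_near_coveringP K).1 cK).
  apply: (cov nat \oo (fun N s =>
    forall s', K s' -> `|s - s'| < t0 / N.+1%:R -> w s' = w s)) => x Kx.
  have [d1 /= d10 hd1] : exists2 d1 : R, 0 < d1 &
      forall s, `|x - s| < d1 -> K s -> w s = w x.
    have /cvgrPdist_lt/(_ _ ltr01) := (subspace_continuousP K f).1 fK x Kx.
    rewrite near_withinE => -[d1 d10 hd1]; exists d1 => // s /hd1 /[apply].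
    rewrite /f => fxs; suff e1 : index (w s) r = index (w x) r.
      by rewrite -[LHS](nth_index (w x) (wr s)) e1 nth_index.
    exact/esym/(natr_dist_lt1 fxs).
  have d12 : 0 < d1 / 2 by rewrite divr_gt0.
  exists (ball x (d1 / 2), [set i : nat | t0 / i.+1%:R < d1 / 2]) => /=.
    split; first exact: nbhsx_ballx.
    have [n hn] := natr_gt (t0 / (d1 / 2)); exists n => // i /= ni.
    rewrite ltr_pdivrMr// mulrC -ltr_pdivrMr//; apply: lt_le_trans hn _.
    by rewrite ler_nat ltnW.
  move=> [y i] /= [xy yi] Ky s' Ks' ys'.
  rewrite /ball/= in xy; rewrite (hd1 s') ?(hd1 y)//.
    by rewrite (lt_trans xy)// gtr_pMr// invf_lt1// ltr1n.
  by rewrite (le_lt_trans (ler_distD y _ _))// (splitr d1) ltrD// (lt_trans ys').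
have [n _ hn] := near_const; have {hn}hK := hn n (leqnn n).
pose N := n.+1; have N0 : (0 < N)%N by [].
(* The value of [w] on the part of cell [k] inside [K], or 0 when the cell misses [K]. *)
have /choice[a ha] (k : nat) : exists v, rnorm v <= m /\
    forall s, K s -> cell N s = k -> w s = v.
  have [[s1 Ks1 s1k]|nk] := pselect (exists2 s, K s & cell N s = k).
    exists (w s1); split => // s Ks sk; apply: hK => //.
    have /KD := Ks; have /KD := Ks1; rewrite /= !in_itv/= => st1 st.
    have /andP[h1 h2] := cell_itv N0 st1; have /andP[h3 h4] := cell_itv N0 st.
    rewrite s1k sk -/N -natr1 !mulrDl mul1r in h1 h2 h3 h4.
    by rewrite ltr_norml; apply/andP; split; rewrite -/N; lra.
  exists 0; rewrite rnorm0; split => // s Ks sk; exfalso; apply: nk.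
  by exists s.
exists N, a; split => //.
have mDK : measurable (D `\` K) by exact: measurableD.
apply: (@le_trans _ _ (\int[mu]_(s in D) ((4 * m ^+ 2)%:E * (\1_(D `\` K) s)%:E))%E).
  apply: ge0_le_integral => //.
  - by move=> s _; rewrite lee_fin sqr_ge0.
  - apply: measurable_rnorm2; apply: strongly_measurableB.
      exact: strongly_measurable_simple.
    by apply: strongly_measurable_simple; exact: simple_cell.
  - by apply: measurable_funeM; apply/measurable_EFinP/measurable_indic.
  - move=> s Ds; rewrite -EFinM lee_fin indicE.
    have [Ks|nKs] := pselect (K s).
      have [_ /(_ s Ks erefl) ->] := ha (cell N s).
      rewrite subrr rnorm0 expr0n/= mulr_ge0// mulr_ge0// sqr_ge0//.
    rewrite mem_set// mulr1.
    have [am _] := ha (cell N s).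
    have : rnorm (w s - a (cell N s)) <= 2 * m.
      by rewrite (le_trans (rnormB _ _))//; have := wm s; lra.
    by have := rnorm_ge0 (w s - a (cell N s)); nra.
rewrite ge0_integralZl_EFin//; last 2 first.
- by apply/measurable_EFinP/measurable_indic.
- by rewrite mulr_ge0// sqr_ge0.
rewrite integral_indic//= setIidl; last by move=> s [].
apply: (@le_trans _ _ ((4 * m ^+ 2)%:E * d%:E)%E).
  by apply: lee_wpmul2l (ltW muK); rewrite lee_fin mulr_ge0// sqr_ge0.
by rewrite -EFinM lee_fin /d mulrCA ger_pMr// ler_pdivrMr// mul1r lerDl.
Qed.

Lemma LpB2_cell_approx (V : normedModType R[i]) (u : R -> V) (e : R) : 0 < e ->
  LpB 2%:E D u -> exists N (a : nat -> V), (0 < N)%N /\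
    (norm2 t0 (fun s => u s - a (cell N s))%R <= e%:E)%E.
Proof.
move=> e0 [mu0 /finite_norm2P u2]; have e4 : 0 < e / 4 by rewrite divr_gt0.
have [w hw uw] := norm2_simple_approx e4 mu0 u2.
have [N [a [N0 wa]]] := simple_cell_approx e4 hw.
exists N, a; split => //.
have mw := strongly_measurable_simple D hw.
have ma := strongly_measurable_simple D (simple_cell a N0).
have := @le_norm2 _ _ t0 (fun s => u s - a (cell N s)) (fun s => u s - w s)
  (fun s => w s - a (cell N s)) 2 2.
move=> h; apply: le_trans.
  apply: h => //; try exact: strongly_measurableB.
  move=> s _; have := rnorm_distD (w s) (u s) (a (cell N s)).
  have := rnorm_ge0 (u s - a (cell N s)).
  move: (rnorm (u s - w s)) (rnorm (w s - a (cell N s))) => x y.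
  by have := sqr_ge0 (x - y); nra.
apply: (@le_trans _ _ (2%:E * (e / 4)%:E + 2%:E * (e / 4)%:E)%E).
  by apply: leeD; apply: lee_wpmul2l => //; rewrite lee_fin.
by rewrite -!EFinM -EFinD lee_fin; lra.
Qed.

(** Integrates x <= d + x^2 / d; with [d] free this replaces Cauchy-Schwarz and avoids square
    roots. *)
Lemma le_integral_norm2 (V : normedModType R[i]) (f : R -> V) (d : R) : 0 < d ->
  strongly_measurable D f ->
  (\int[mu]_(s in D) (rnorm (f s))%:E <= (d * t0)%:E + d^-1%:E * norm2 t0 f)%E.
Proof.
move=> d0 mf.
have muD : mu D = t0%:E by rewrite lebesgue_measure_itv/= lte_fin t0_gt0 sube0.
rewrite EFinM -muD -integral_cst// -ge0_integralZl_EFin//; last 3 first.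
- by move=> s _; rewrite lee_fin sqr_ge0.
- exact: measurable_rnorm2.
- by rewrite invr_ge0 ltW.
rewrite -ge0_integralD//; last 3 first.
- by move=> s _; rewrite lee_fin ltW.
- by move=> s _; rewrite mule_ge0// lee_fin ?sqr_ge0// invr_ge0 ltW.
- by apply: measurable_funeM; exact: measurable_rnorm2.
apply: ge0_le_integral => //.
- by move=> s _; rewrite lee_fin rnorm_ge0.
- by apply/measurable_EFinP; exact: measurable_rnorm.
- apply: emeasurable_funD => //; apply: measurable_funeM.
  exact: measurable_rnorm2.
- move=> s _; rewrite -EFinM -EFinD lee_fin.
  have x0 := rnorm_ge0 (f s); set x := rnorm (f s) in x0 *.
  rewrite -(ler_pM2l d0) mulrDr mulrA divff ?gt_eqF// mul1r.
  by have := sqr_ge0 (x - d); have := sqr_ge0 d; nra.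
Qed.

End cells.

Lemma simple_fun_bounded (R : realType) (V : normedModType R[i]) (s : R -> V) :
  simple_fun s -> exists2 C : R, 0 <= C & forall x, rnorm (s x) <= C.
Proof.
move=> /simple_funP[r [ur sr _]]; exists (\sum_(v <- r) rnorm v).
  by apply: sumr_ge0 => v _; exact: rnorm_ge0.
move=> x; rewrite (bigD1_seq (s x))//= lerDl.
by apply: sumr_ge0 => v _; exact: rnorm_ge0.
Qed.

(** * The input map *)

Section input_map.
Variables (R : realType) (X Y U : completeNormedModType R[i]).
Variables (S : R -> Y -> Y) (j : X -> Y) (B : U -> Y).
Hypotheses (hS : C0_semigroup S) (bj : bounded_linear j) (ij : injective j).
Hypothesis bB : bounded_linear B.
Local Notation mu := (@lebesgue_measure R).
Local Notation D t0 := (`]0, t0[%classic : set R).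

Definition conv (t0 : R) (u : R -> U) (s : R) : Y := S (t0 - s) (B (u s)).

(** A relation rather than a map, because the integral in [Y] need not come from [X]; injectivity of
    [j] makes the state [x] unique. *)
Definition input (t0 : R) (u : R -> U) (x : X) :=
  is_bochner_integral (D t0) (conv t0 u) (j x).

Let S_bounded t : 0 <= t -> bounded_linear (S t).
Proof. by case: hS => h _ _ _ /h. Qed.

Lemma strongly_measurable_conv (t0 : R) (u : R -> U) : 0 < t0 ->
  strongly_measurable (D t0) u -> strongly_measurable (D t0) (conv t0 u).
Proof.
move=> t00 [s hs su].
(* Time is frozen at the left endpoint of the cell of [x], so the argument of [S] tends to [t0 - x]
   from above, as [semigroup_cvg] requires. *)
pose c n x := if x \in D t0 then
  S (t0 - (cell t0 n.+1 x)%:R * (t0 / n.+1%:R)) (B (s n x)) else 0.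
exists c => [n|x Dx].
  have /simple_funP[r hr] := hs n; apply/simple_funP.
  have mD : fsimple (fun x => x \in D t0) [:: true; false] by exact: fsimple_mem.
  eexists; exact: (fsimple_comp (fsimple_pair mD (fsimple_pair
    (fsimple_cell t00 (ltn0Sn n)) hr)) (fun z =>
      if z.1 then S (t0 - z.2.1%:R * (t0 / n.+1%:R)) (B z.2.2) else 0)).
have xt : 0 < x < t0 by move: Dx; rewrite /= in_itv.
have /andP[x0 xt0] := xt.
pose h n := x - (cell t0 n.+1 x)%:R * (t0 / n.+1%:R).
have hP n : 0 <= h n <= t0 / n.+1%:R.
  have /andP[h1 h2] := cell_itv t00 (ltn0Sn n) xt.
  rewrite /h subr_ge0 h1/= lerBlDl (le_trans (ltW h2))//.
  by rewrite -natr1 mulrDl mul1r.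
rewrite (_ : (fun n => c n x) = (fun n => S ((t0 - x) + h n) (B (s n x)))).
  apply: semigroup_cvg => //.
  - by rewrite subr_ge0 ltW.
  - by move=> n; have /andP[] := hP n.
  - apply: (@squeeze_cvgr _ _ _ _ (fun=> 0) (fun n => t0 * n.+1%:R^-1)).
    + by apply: nearW => n; exact: hP.
    + exact: cvg_cst.
    + rewrite -[X in _ --> X](mulr0 t0).
      by apply: cvgM; [exact: cvg_cst|exact: cvg_harmonic].
  - by apply: bounded_linear_cvg => //; exact: su.
by apply/funext => n; rewrite /c mem_set// /h addrA subrK.
Qed.

Lemma rnorm_conv (t0 : R) : exists2 K : R, 0 < K &
  forall u s, D t0 s -> rnorm (conv t0 u s) <= K * rnorm (u s).
Proof.
have [M M0 hM] := semigroup_bound hS t0.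
have [K K0 hK] := bounded_linear_gt0 bB.
exists (M * K) => [|u s]; first exact: mulr_gt0.
rewrite /= in_itv/= => /andP[s0 st]; rewrite (le_trans (hM _ _ _))//.
  by rewrite subr_ge0 (ltW st)/= gerBl ltW.
by rewrite -mulrA ler_pM2l.
Qed.

Lemma conv_lin (t0 : R) (a : R[i]) (u v : R -> U) s : D t0 s ->
  conv t0 (fun s => a *: u s + v s) s = a *: conv t0 u s + conv t0 v s.
Proof.
rewrite /= in_itv/= => /andP[s0 st].
have st0 : 0 <= t0 - s by rewrite subr_ge0 ltW.
by rewrite /conv bB.1 (S_bounded st0).1.
Qed.

Lemma input_lin (t0 : R) (a : R[i]) (u v : R -> U) (x y : X) :
  input t0 u x -> input t0 v y ->
  input t0 (fun s => a *: u s + v s) (a *: x + y).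
Proof.
move=> ux vy; rewrite /input bj.1.
apply: (@eq_is_bochner_integral _ _ _ _
  (fun s => a *: conv t0 u s + conv t0 v s)) => //.
  by move=> s Ds; rewrite conv_lin.
apply: is_bochner_integralD => //; first exact: measure_itv0.
by apply: is_bochner_integral_lin => //; [exact: measure_itv0|exact: bounded_linearZ].
Qed.

Lemma inputB (t0 : R) (u v : R -> U) (x y : X) :
  input t0 u x -> input t0 v y -> input t0 (fun s => u s - v s) (x - y).
Proof.
move=> ux vy; have := input_lin (-1) vy ux.
by rewrite scaleN1r addrC; under eq_fun do rewrite scaleN1r addrC.
Qed.

Lemma input_unique (t0 : R) (u : R -> U) (x y : X) :
  input t0 u x -> input t0 u y -> x = y.
Proof.
move=> ux uy; apply: ij.
by apply: is_bochner_integral_unique ux uy => //; exact: measure_itv0.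
Qed.

Lemma rnorm_input_le (t0 : R) : 0 < t0 -> exists2 K : R, 0 < K &
  forall u x (C : R), input t0 u x -> (forall s, rnorm (u s) <= C) ->
    rnorm (j x) <= K * C.
Proof.
move=> t00; have [K K0 hK] := rnorm_conv t0.
exists (K * t0) => [|u x C ux uC]; first exact: mulr_gt0.
have mc := strongly_measurable_bochner ux.
have muD : mu (D t0) = t0%:E by rewrite lebesgue_measure_itv/= lte_fin t00 sube0.
rewrite -lee_fin; apply: le_trans (rnorm_bochner_le _ _ ux) _ => //.
  exact: measure_itv0.
rewrite mulrAC EFinM -muD -integral_cst//; apply: ge0_le_integral => //.
- by move=> s _; rewrite lee_fin rnorm_ge0.
- by apply/measurable_EFinP; exact: measurable_rnorm.
- by move=> s Ds; rewrite lee_fin (le_trans (hK _ _ Ds))// ler_pM2l.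
Qed.

Hypothesis hX : parallelogram X.

(* A closed graph argument: were the input map unbounded, a gliding hump would
   produce a bounded input whose image has norm larger than every integer. *)
Lemma input_bounded (t0 : R) : 0 < t0 ->
  (forall u, LpB +oo%E (D t0) u -> exists x, input t0 u x) ->
  exists2 M : R, 0 < M & forall u x (C : R), simple_fun u -> 0 < C ->
    (forall s, rnorm (u s) <= C) -> input t0 u x -> rnorm x <= M * C.
Proof.
move=> t00 adm.
suff [M hM] : exists M : R, forall u x, simple_fun u ->
    (forall s, rnorm (u s) <= 1) -> input t0 u x -> rnorm x <= M.
  exists (`|M| + 1) => [|u x C hu C0 uC ux]; first by rewrite ltr_wpDl.
  have C0' : 0 <= C^-1 by rewrite invr_ge0 ltW.
  have ux' : input t0 (fun s => C^-1%:C *: u s + 0) (C^-1%:C *: x + 0).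
    apply: (input_lin _ ux); have := inputB ux ux; rewrite subrr.
    by under eq_fun do rewrite subrr.
  have := hM _ _ _ _ ux'; rewrite addr0 rnormZr ger0_norm// ler_pdivrMl// mulrC.
  move=> h; rewrite (le_trans (h _ _))//.
  - exact: (simple_fun_comp1 (fun v => C^-1%:C *: v + 0)).
  - by move=> s; rewrite addr0 rnormZr ger0_norm// ler_pdivrMl// mulr1.
  - by rewrite ler_pM2r// (le_trans (ler_norm _))// lerDl.
apply: contrapT => nbd.
have big (M : R) : exists u x, [/\ simple_fun u, forall s, rnorm (u s) <= 1,
    input t0 u x & M < rnorm x].
  apply: contrapT => h; apply: nbd; exists M => u x hu u1 ux.
  by rewrite leNgt; apply/negP => Mx; apply: h; exists u, x.
have adm_simple u : simple_fun u -> exists x, input t0 u x.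
  move=> hu; have [C C0 uC] := simple_fun_bounded hu.
  apply: adm; apply: (LpB_pinfty_bounded (C := C)) => //.
  exact: strongly_measurable_simple.
have [K K0 hK] := rnorm_input_le t00.
pose O (n : nat) : set (R -> U) := [set g | forall x, input t0 g x -> n%:R < rnorm x].
have [||g [s [hs sg g1 gO]]] := @nested_balls R U R (@simple_fun R U) O (fun=> 0).
- exact: simple_fun_cst.
- move=> n f r hf r0; have [x fx] := adm_simple _ hf.
  have [v [z [hv v1 vz zbig]]] := big ((n%:R + rnorm x) / (r / 2)).
  have r2 : 0 < r / 2 by rewrite divr_gt0.
  rewrite ltr_pdivrMr// mulrC in zbig.
  pose f' s : U := (r / 2)%:C *: v s + f s.
  have f'x := input_lin (r / 2)%:C vz fx.
  set x' := _ + x in f'x.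
  have x'n : n%:R < rnorm x'.
    have : rnorm ((r / 2)%:C *: z) <= rnorm x' + rnorm x.
      by rewrite (_ : _ *: z = x' - x) ?rnormB// /x' addrK.
    by rewrite rnormZr gtr0_norm//; lra.
  (* The ball of radius [n] in [X] is closed for the norm of [Y], so a whole [Y]-neighbourhood of
     [x'] avoids it. *)
  have [d d0 hd] : exists2 d : R, 0 < d & forall y, rnorm (j y - j x') < d ->
      n%:R < rnorm y.
    apply: contrapT => h; move: x'n; apply/negP; rewrite -leNgt.
    apply: (weak_norm_le hX bj ij) => d d0; apply: contrapT => h'; apply: h.
    exists d => // y yd; rewrite ltNge; apply/negP => yn; apply: h'.
    by exists y.
  (* Inputs uniformly within [r'] of [f'] have states within [K * r' <= d / 2] in the norm of
     [Y]. *)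
  pose r' := Num.min (r / 2) (d / (2 * K)).
  have r'0 : 0 < r' by rewrite lt_min r2/= divr_gt0// mulr_gt0.
  exists f', r'; split => //.
  + exact: (simple_fun_comp2 (fun a b => (r / 2)%:C *: a + b)).
  + by rewrite r'0 ge_min lexx.
  + by move=> s; rewrite /f' addrK rnormZr gtr0_norm// ler_piMr// ltW.
  + move=> g gf' y gy; apply: hd; rewrite -(linB bj.1).
    have := hK _ _ _ (inputB gy f'x) gf' => /le_lt_trans; apply.
    have : r' <= d / (2 * K) by rewrite ge_min lexx orbT.
    rewrite ler_pdivlMr ?mulr_gt0// => h.
    by rewrite mulrC -(ltr_pM2r (_ : 0 < 2 :> R))//; lra.
(* The centers [s] are simple and converge to [g] pointwise, so [g] is strongly measurable; being
   bounded by 1, it has a state. *)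
have [x gx] : exists x, input t0 g x.
  apply: adm; apply: (LpB_pinfty_bounded (C := 1)).
    by exists s => // i _; exact: sg.
  by move=> i _; rewrite -[g i]subr0.
have [n hn] := natr_gt (rnorm x).
by have := gO n _ gx; rewrite ltNge ltW.
Qed.

End input_map.

(** * Square integrable inputs *)

Section step_inputs.
Variables (R : realType) (X Y U : completeNormedModType R[i]).
Variables (T : R -> X -> X) (S : R -> Y -> Y) (j : X -> Y) (B : U -> Y).
Hypotheses (hT : C0_semigroup T) (hS : C0_semigroup S).
Hypotheses (bj : bounded_linear j) (ij : injective j) (bB : bounded_linear B).
Hypothesis Sj : forall t x, 0 <= t -> S t (j x) = j (T t x).
Hypothesis adm : forall (t0 : R) u, 0 < t0 -> LpB +oo%E `]0, t0[%classic u ->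
  exists x, input S j B t0 u x.
Local Notation mu := (@lebesgue_measure R).
Local Notation D t0 := (`]0, t0[%classic : set R).
Local Notation input := (input S j B).
Local Notation conv := (conv S B).

Lemma constant_input (h : R) : 0 < h -> exists2 b : U -> X,
  linear b & forall v, input h (fun=> v) (b v).
Proof.
move=> h0; have /choice[b hb] (v : U) : exists x, input h (fun=> v) x.
  apply: adm => //; apply: (LpB_pinfty_bounded (C := rnorm v)) => //.
  by apply: strongly_measurable_simple; exact: simple_fun_cst.
exists b => // a v w; apply: (input_unique ij (hb _)).
exact: input_lin.
Qed.

(** Translates of the open interval ]0, h[ miss the grid points, which the half-open cells contain;
    the two descriptions of a step input agree elsewhere. *)
Lemma negligible_grid (h : R) (P : R -> Prop) :
  (forall s, (forall k : nat, s != k%:R * h) -> P s) -> {ae mu, forall s, P s}.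
Proof.
move=> hP; pose A := [set k%:R * h | k in [set: nat]].
have cA : countable A by apply: sub_countable (card_image_le _ _) _; exact: countableP.
exists A; split.
- by apply: countable_measurable cA => r; exact: measurable_set1.
- exact: countable_lebesgue_measure0.
- move=> s nPs; apply: contrapT => nA; apply: nPs; apply: hP => k.
  by apply/eqP => sk; apply: nA; exists k.
Qed.

(** Cell [k] produces the state [b (a k)] at its right end, which then evolves freely during the
    [N.-1 - k] remaining cells. *)
Lemma input_grid (h : R) (b : U -> X) (N : nat) (a : nat -> U) :
  0 < h -> (forall v, input h (fun=> v) (b v)) -> (0 < N)%N ->
  input (N%:R * h) (fun s => a (cell (N%:R * h) N s))
    (\sum_(k < N) T ((N.-1 - k)%:R * h) (b (a k))).
Proof.
move=> h0 hb N0; set t0 := N%:R * h.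
have N0' : 0 < N%:R :> R by rewrite ltr0n.
have t00 : 0 < t0 by rewrite mulr_gt0.
have hE : t0 / N%:R = h by rewrite /t0 mulrAC divff ?mul1r// gt_eqF.
pose f (k : nat) (s : R) := S (h - s) (B (a k)).
pose g (k : nat) (s : R) : Y := S ((N.-1 - k)%:R * h) (f k s).
pose G (k : 'I_N) (s : R) : Y :=
  if s - k%:R * h \in D h then g k (s - k%:R * h) else 0.
have finD t : (mu (D t) < +oo)%E by exact: measure_itv0.
have n0 (n : nat) : 0 <= n%:R * h by rewrite mulr_ge0// ltW.
have hG (k : 'I_N) : is_bochner_integral (D t0) (G k)
    (j (T ((N.-1 - k)%:R * h) (b (a k)))).
  apply: is_bochner_integral_translation => //.
    move=> s /=; rewrite !in_itv/= => /andP[s0 sh].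
    rewrite ltr_wpDr//= (lt_le_trans (_ : _ < h + k%:R * h)) ?ltrD2r//.
    rewrite -[X in X + _]mul1r -mulrDl ler_pM2r// nat1r ler_nat.
    exact: ltn_ord.
  rewrite -Sj//; apply: is_bochner_integral_lin => //; last exact: hb.
  by have [bS _ _ _] := hS; exact: bS.
have hsum := is_bochner_integral_sum _ (finD t0) (index_enum 'I_N) hG.
rewrite -(lin_sum bj.1) in hsum.
have msum := strongly_measurable_bochner (hsum _).
have mconv : strongly_measurable (D t0) (conv t0 (fun s => a (cell t0 N s))).
  apply: (strongly_measurable_conv hS bB) => //.
  by apply: strongly_measurable_simple; exact: simple_cell.
apply: is_bochner_integral_lim => //.
move=> e e0; exists (fun s => \sum_(k < N) G k s).
eexists; split; first exact: hsum.
  rewrite /dist1 (@ge0_ae_eq_integral _ _ _ mu _ _ (cst 0%E))//.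
  - by rewrite integral0 lee_fin ltW.
  - apply/measurable_EFinP; apply: measurable_rnorm => //.
    by apply: strongly_measurableB => //; exact: msum.
  - by move=> s _; rewrite lee_fin rnorm_ge0.
  apply: (@negligible_grid h) => s sh Ds.
  have st : 0 < s < t0 by move: Ds; rewrite /= in_itv.
  have := cell_itv t00 N0 st; rewrite hE.
  have := cell_lt t00 N0 s; set q := cell t0 N s => qN /andP[q1 q2].
  have nS (k : nat) : k.+1%:R * h = h + k%:R * h by rewrite -nat1r mulrDl mul1r.
  have q1' : q%:R * h < s by rewrite lt_neqAle eq_sym sh.
  have GE (k : 'I_N) : G k s = if k == Ordinal qN then conv t0 (fun=> a q) s else 0.
    rewrite /G; case: eqP => [->|kq] /=.
      rewrite mem_set; last by rewrite /= in_itv/= subr_gt0 q1' ltrBlDr -nS.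
      rewrite /g /f; have [_ _ SD _] := hS; rewrite -SD//.
        congr (S _ _); rewrite /t0 -subn1 -subnDA natrB ?add1n// -natr1; ring.
      by rewrite subr_ge0 lerBlDr -nS ltW.
    rewrite ifF//; apply/negP => /set_mem/=; rewrite in_itv/= subr_gt0 ltrBlDr.
    rewrite -nS => /andP[k1 k2]; apply: kq.
    by apply/val_inj/esym/eqP; rewrite /= /q cell_eq// hE (ltW k1).
  rewrite (eq_bigr _ (fun k _ => GE k)) -big_mkcond big_pred1_eq.
  by rewrite /conv subrr rnorm0.
by rewrite subrr rnorm0 ltW.
Qed.

Hypotheses (hX : parallelogram X) (hU : parallelogram U).
Hypothesis liT : left_invertible T.

Let delay (N i : nat) (a : nat -> U) (k : nat) : U :=
  if (i <= k)%N && (k - i < N)%N then a (k - i)%N else 0.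

(** Double counting of the pairs with i + l = k: each [l] occurs for at most one delay [i]. *)
Let sum_delay (N k : nat) (a : nat -> U) :
  \sum_(i < N) rnorm (delay N i a k) ^+ 2 <= \sum_(l < N) rnorm (a l) ^+ 2 :> R.
Proof.
have e (i : 'I_N) : rnorm (delay N i a k) ^+ 2 =
    \sum_(l < N) (if (i + l == k)%N then rnorm (a l) ^+ 2 else 0).
  rewrite /delay; case: ifPn => [/andP[ik kiN]|nk].
    rewrite (bigD1 (Ordinal kiN))//= subnKC// eqxx big1 ?addr0// => l lk.
    case: eqP => // ilk; move: lk; rewrite -(inj_eq val_inj)/= -ilk addKn.
    by rewrite eqxx.
  rewrite rnorm0 expr0n big1// => l _; case: eqP => // ilk.
  by move: nk; rewrite -ilk leq_addr addKn ltn_ord.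
under eq_bigr do rewrite e.
rewrite exchange_big/=; apply: ler_sum => l _.
have [lk|lk] := leqP l k; last first.
  rewrite big1 ?sqr_ge0// => i _; case: eqP => // ilk.
  by move: lk; rewrite -ilk ltnNge leq_addl.
have [klN|klN] := ltnP (k - l) N; last first.
  rewrite big1 ?sqr_ge0// => i _; case: eqP => // ilk.
  by move: klN; rewrite -ilk addnK leqNgt ltn_ord.
rewrite (bigD1 (Ordinal klN))//= subnK// eqxx big1 ?addr0// => i ik.
case: eqP => // ilk; move: ik; rewrite -(inj_eq val_inj)/= -ilk addnK.
by rewrite eqxx.
Qed.

(* Delaying by [i] cells an input supported in [0, t0] leads at time [2 * t0] to
   the image under [T ((N - i) * h)], which is bounded below, of its state at
   time [t0].  In a given cell the [N] delays take distinct values of the input,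
   so the 2-summing inequality turns into an [L^2] bound. *)
Lemma step_input_bound (t0 : R) : 0 < t0 -> exists2 C : R, 0 <= C &
  forall N (a : nat -> U) x, (0 < N)%N ->
    input t0 (fun s => a (cell t0 N s)) x ->
    rnorm x ^+ 2 <= C * (t0 / N%:R * \sum_(k < N) rnorm (a k) ^+ 2).
Proof.
move=> t00; have t20 : 0 < t0 + t0 by rewrite addr_gt0.
have [M M0 hM] := input_bounded hS bj ij bB hX t20 (fun u => @adm _ u t20).
have [c c0 hc] := left_invertible_lower_bound hT (ltW t00) liT.
(* With m the sum of the squares |a k|^2, the [N] delays give N c^2 |x|^2 <= 48 M^2 m; dividing by N
   and writing 1 / N as the mesh over [t0] yields this constant. *)
exists (48 * M ^+ 2 / (c ^+ 2 * t0)).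
  by rewrite divr_ge0// mulr_ge0 ?sqr_ge0// ltW.
move=> N a x N0 ax; set h := t0 / N%:R.
have h0 : 0 < h := mesh_gt0 t00 N0.
have Nh : N%:R * h = t0 := mulr_mesh t0 N0.
have [b lb hb] := constant_input h0.
have [bT _ TD _] := hT.
have n0 (n : nat) : 0 <= n%:R * h by rewrite mulr_ge0// ltW.
have lT (n : nat) : linear (T (n%:R * h)) by case: (bT _ (n0 n)).
pose Phi (n : nat) (u : nat -> U) := \sum_(k < n) T ((n.-1 - k)%:R * h) (b (u k)).
have PhiD n (u v : nat -> U) : Phi n (u + v) = Phi n u + Phi n v.
  by rewrite /Phi -big_split/=; apply: eq_bigr => k _; rewrite (linD lb) (linD (lT _)).
have PhiB n (u v : nat -> U) : Phi n (u - v) = Phi n u - Phi n v.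
  by rewrite /Phi -sumrB; apply: eq_bigr => k _; rewrite (linB lb) (linB (lT _)).
have N20 : (0 < N + N)%N by rewrite addn_gt0 N0.
have PhiM (u : nat -> U) (C : R) : 0 <= C ->
    (forall k, (k < N + N)%N -> rnorm (u k) <= C) -> rnorm (Phi (N + N)%N u) <= M * C.
  (* [input_bounded] asks for a positive bound, so [C] is enlarged by [e / M]. *)
  move=> C0 uC; apply/ler_addgt0Pr => e e0.
  have := input_grid u h0 hb N20; rewrite natrD mulrDl Nh => hPhi.
  have -> : M * C + e = M * (C + e / M) by field; rewrite gt_eqF.
  apply: hM hPhi.
  - exact: simple_cell.
  - by rewrite ltr_wpDl// divr_gt0.
  - move=> s; rewrite (le_trans (uC _ _))//; first exact: cell_lt.
    by rewrite lerDl divr_ge0// ltW.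
have xE : x = Phi N a.
  by apply: (input_unique ij ax); have := input_grid a h0 hb N0; rewrite Nh.
have Phi_delay i : (i < N)%N -> Phi (N + N)%N (delay N i a) = T ((N - i)%:R * h) x.
  move=> iN; rewrite xE /Phi (lin_sum (lT _)).
  pose F k := T (((N + N).-1 - k)%:R * h) (b (delay N i a k)).
  have F0 k : ~~ ((i <= k)%N && (k - i < N)%N) -> F k = 0.
    by rewrite /F /delay => /negbTE ->; rewrite (lin0 lb) (lin0 (lT _)).
  (* Cells before [i] and from [i + N] on carry no input. At k = i + l the exponent (N + N).-1 - k
     splits as (N - i) + (N.-1 - l), which factors out [T ((N - i)%:R * h)]. *)
  rewrite -(big_mkord xpredT F) (@big_cat_nat _ _ _ i)//=; last first.
    by rewrite (leq_trans (ltnW iN))// leq_addr.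
  rewrite big_nat big1 ?add0r; last first.
    by move=> k /= ki; apply: F0; rewrite leqNgt ki.
  rewrite (@big_cat_nat _ _ _ (i + N))//=; [|exact: leq_addr|by rewrite leq_add2r ltnW].
  rewrite [X in _ + X]big_nat [X in _ + X]big1 ?addr0; last first.
    move=> k /andP[ik _]; apply: F0.
    by rewrite negb_and -leqNgt leq_subRL ?ik ?orbT// (leq_trans _ ik)// leq_addr.
  rewrite -{1}(add0n i) big_addn addKn big_mkord; apply: eq_bigr => l _.
  rewrite /F /delay leq_addl addnK ltn_ord/= -TD// -mulrDl -natrD.
  congr (T (_%:R * h) _); rewrite -!subn1.
  have := ltn_ord l; move: (val l) => l' l'N.
  by rewrite addnBA ?addnBAC; lia.
apply/ler_addgt0Pr => e e0.
pose m := \sum_(l < N) rnorm (a l) ^+ 2.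
have m0 : 0 <= m by apply: sumr_ge0 => l _; rewrite sqr_ge0.
set K := 48 * M ^+ 2 / (c ^+ 2 * t0).
have K0 : 0 < K by rewrite divr_gt0// mulr_gt0// exprn_gt0.
(* [two_summing] needs a positive bound: m is replaced by m + d, which costs exactly [e] in the
   end. *)
pose d := e / (K * h).
have d0 : 0 < d by rewrite divr_gt0// mulr_gt0.
have md : 0 < m + d by rewrite ltr_wpDl.
have := @two_summing _ _ _ hU hX (Phi (N + N)%N) (N + N)%N M (PhiD _) (PhiB _)
  PhiM [seq delay N i a | i <- iota 0 N] _ md.
rewrite big_map -[X in iota 0 X](subn0 N) -/(index_iota 0 N) big_mkord.
have hsum k : (k < N + N)%N ->
    \sum_(u <- [seq delay N i a | i <- index_iota 0 N]) rnorm (u k) ^+ 2 <= m + d.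
  move=> _; rewrite big_map big_mkord (le_trans (sum_delay N k a))//.
  by rewrite lerDl ltW.
move=> /(_ hsum) hle.
have : N%:R * (c * rnorm x) ^+ 2 <= 48 * M ^+ 2 * (m + d).
  apply: le_trans hle; rewrite mulr_natl -[X in _ *+ X](card_ord N) -sumr_const.
  apply: ler_sum => i _; rewrite Phi_delay//.
  rewrite lerXn2r ?nnegrE ?rnorm_ge0//; first by rewrite mulr_ge0 ?rnorm_ge0// ltW.
  by apply: hc; rewrite n0/= -Nh ler_pM2r// ler_nat leq_subr.
have N0' : 0 < N%:R :> R by rewrite ltr0n.
have Nc0 : 0 < N%:R * c ^+ 2 by rewrite mulr_gt0// exprn_gt0.
rewrite exprMn [leLHS]mulrA -(ler_pdivlMl _ _ Nc0) => hx.
apply: (le_trans hx).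
have -> : K * (h * \sum_(k < N) rnorm (a k) ^+ 2) + e = K * h * (m + d).
  by rewrite -/m mulrDr mulrA /d; congr (_ + _); field; rewrite !gt_eqF.
rewrite le_eqVlt; apply/orP; left; apply/eqP.
by rewrite /K /h; field; rewrite !gt_eqF.
Qed.

(** The step input bound on common refinements makes the states of step approximants Cauchy in [X],
    while their integrands converge in L^1 with values in [Y]. *)
Lemma L2_input (t0 : R) (u : R -> U) : 0 < t0 -> LpB 2%:E (D t0) u ->
  exists x, input t0 u x.
Proof.
move=> t00 hu; have mu0 := hu.1.
have finD : (mu (D t0) < +oo)%E by exact: measure_itv0.
have [C C0 hC] := step_input_bound t00.
have approx (n : nat) : exists p : nat * (nat -> U) * X, [/\ (0 < p.1.1)%N,
    (norm2 t0 (fun s => u s - p.1.2 (cell t0 p.1.1 s))%R <= n.+1%:R^-1%:E)%E &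
    input t0 (fun s => p.1.2 (cell t0 p.1.1 s)) p.2].
  have n0 : 0 < n.+1%:R^-1 :> R by rewrite invr_gt0.
  have [N [a [N0 ua]]] := LpB2_cell_approx t00 n0 hu.
  have ha := simple_cell t00 a N0.
  have [c _ ac] := simple_fun_bounded ha.
  have [|x ax] := adm (u := fun s => a (cell t0 N s)) t00.
    by apply: (LpB_pinfty_bounded (C := c)) => //; exact: strongly_measurable_simple.
  by exists (N, a, x).
have /choice[p hp] := approx.
pose v n s := (p n).1.2 (cell t0 (p n).1.1 s).
have sv n : simple_fun (v n) by have [N0 _ _] := hp n; exact: simple_cell.
have mv n : strongly_measurable (D t0) (v n) by exact: strongly_measurable_simple.
have dist n k : rnorm ((p n).2 - (p k).2) ^+ 2 <=
    C * (2 * n.+1%:R^-1 + 2 * k.+1%:R^-1).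
  have [N0 un an] := hp n; have [K0 uk ak] := hp k.
  set N := (p n).1.1 in N0 *; set K := (p k).1.1 in K0 *.
  have NK0 : (0 < N * K)%N by rewrite muln_gt0 N0.
  pose d i := (p n).1.2 (i %/ K)%N - (p k).1.2 (i %/ N)%N.
  have dE s : d (cell t0 (N * K) s) = v n s - v k s.
    by rewrite /d /v -cell_refine// [in X in _ - X]mulnC -cell_refine.
  have hd : input t0 (fun s => d (cell t0 (N * K) s)) ((p n).2 - (p k).2).
    by under eq_fun do rewrite dE; exact: inputB.
  apply: (le_trans (hC _ _ _ NK0 hd)); apply: ler_wpM2l => //.
  rewrite -lee_fin.
  apply: (le_trans (integral_cell t00 NK0 (fun k => sqr_ge0 (rnorm (d k))))).
  under eq_integral do rewrite dE.
  apply: (@le_trans _ _ (2%:E * norm2 t0 (fun s => u s - v n s)%R +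
     2%:E * norm2 t0 (fun s => u s - v k s)%R)%E).
    apply: (@le_norm2 _ _ t0 (fun s => v n s - v k s)) => //;
      try exact: strongly_measurableB.
    move=> s _; have := rnorm_distD (u s) (v n s) (v k s).
    rewrite [rnorm (v n s - u s)]rnorm_distC.
    have := rnorm_ge0 (v n s - v k s).
    move: (rnorm (u s - v n s)) (rnorm (u s - v k s)) => x y.
    by have := sqr_ge0 (x - y); nra.
  apply: (@le_trans _ _ (2%:E * n.+1%:R^-1%:E + 2%:E * k.+1%:R^-1%:E)%E) => //.
  by apply: leeD; apply: lee_wpmul2l => //; rewrite lee_fin.
have [x hx] : exists x : X, (p n).2 @[n --> \oo] --> x.
  apply: rnorm_cauchy_cvg => e e0.
  (* Beyond [N] the bound in [dist] is below e^2; the [+ 1] covers C = 0. *)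
  have [N hN] := natr_gt (4 * (C + 1) / e ^+ 2).
  exists N => n k Nn Nk.
  have inv i : (N <= i)%N -> i.+1%:R^-1 < e ^+ 2 / (4 * (C + 1)).
    move=> Ni; rewrite -[ltRHS]invrK ltf_pV2 ?posrE ?invr_gt0 ?divr_gt0 ?exprn_gt0
      ?mulr_gt0 ?ltr_wpDl// invf_div.
    by rewrite (lt_le_trans hN)// ler_nat ltnW.
  have e2 : 0 < e ^+ 2 by rewrite exprn_gt0.
  have : rnorm ((p n).2 - (p k).2) ^+ 2 < e ^+ 2.
    apply: (le_lt_trans (dist n k)).
    have := inv _ Nn; have := inv _ Nk.
    move: (n.+1%:R^-1) (k.+1%:R^-1) => y z hy hz.
    have C1 : 0 < C + 1 by rewrite ltr_wpDl.
    have hyz : 2 * z + 2 * y < e ^+ 2 / (C + 1).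
      have -> : e ^+ 2 / (C + 1) =
          2 * (e ^+ 2 / (4 * (C + 1))) + 2 * (e ^+ 2 / (4 * (C + 1))).
        by field; rewrite gt_eqF.
      lra.
    apply: (@le_lt_trans _ _ (C * (e ^+ 2 / (C + 1)))).
      by apply: ler_wpM2l => //; rewrite addrC ltW.
    by rewrite mulrA ltr_pdivrMr// mulrC ltr_pM2l// ltrDl.
  by rewrite ltr_pXn2r ?nnegrE ?rnorm_ge0// ltW.
exists x; apply: is_bochner_integral_lim => //.
  exact: (strongly_measurable_conv hS bB).
have [K K0 hK] := rnorm_conv hS bB t0.
move=> e e0.
(* The L^1 error is at most K (d t0 + d^-1 / (n + 1)): this [d] makes the first term e / 2, and [n]
   is then taken large enough for the second. *)
pose d := e / (2 * K * t0).
have d0 : 0 < d by rewrite divr_gt0// !mulr_gt0.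
have jx : j (p n).2 @[n --> \oo] --> j x by exact: bounded_linear_cvg.
move/cvg_rnormP : jx => /(_ _ e0)[N _ hN].
have [N' hN'] := natr_gt (2 * K / (d * e)).
pose n := maxn N N'.
exists (conv t0 (v n)), (j (p n).2); split.
- by have [] := hp n.
- have [_ un _] := hp n.
  have mun : strongly_measurable (D t0) (fun s => u s - v n s).
    exact: strongly_measurableB.
  apply: (@le_trans _ _ (K%:E * \int[mu]_(s in D t0) (rnorm (u s - v n s))%:E)%E).
    rewrite -ge0_integralZl_EFin//; last 3 first.
    + by move=> s _; rewrite lee_fin rnorm_ge0.
    + by apply/measurable_EFinP; exact: measurable_rnorm.
    + exact: ltW.
    apply: ge0_le_integral => //.
    + by move=> s _; rewrite lee_fin rnorm_ge0.
    + apply/measurable_EFinP; apply: measurable_rnorm => //.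
      by apply: strongly_measurableB => //; exact: (strongly_measurable_conv hS bB).
    + by apply: measurable_funeM; apply/measurable_EFinP; exact: measurable_rnorm.
    + move=> s Ds; rewrite -EFinM lee_fin.
      have -> : conv t0 u s - conv t0 (v n) s =
          conv t0 (fun s => (-1) *: v n s + u s) s.
        by rewrite (conv_lin hS bB)// scaleN1r addrC.
      rewrite (le_trans (hK _ _ Ds))// ler_pM2l//.
      by rewrite scaleN1r addrC.
  apply: (@le_trans _ _ (K%:E * ((d * t0)%:E + d^-1%:E * n.+1%:R^-1%:E))%E).
    apply: lee_wpmul2l; first by rewrite lee_fin ltW.
    apply: (le_trans (le_integral_norm2 t00 d0 mun)).
    apply: leeD2l; apply: lee_wpmul2l => //.
    by rewrite lee_fin invr_ge0 ltW.
  rewrite -[leLHS]/((K * (d * t0 + d^-1 * n.+1%:R^-1))%:E) lee_fin.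
  have h1 : n.+1%:R^-1 <= d * e / (2 * K).
    have q0 : 0 < d * e / (2 * K) by rewrite divr_gt0// mulr_gt0.
    rewrite -[leRHS]invrK lef_pV2 ?posrE ?invr_gt0// invf_div.
    by rewrite ltW// (lt_le_trans hN')// ler_nat ltnW// ltnS leq_maxr.
  have h2 : K * (d * t0) = e / 2 by rewrite /d; field; rewrite !gt_eqF.
  rewrite mulrDr h2; have h3 : K * (d^-1 * n.+1%:R^-1) <= e / 2.
    apply: (@le_trans _ _ (K * (d^-1 * (d * e / (2 * K))))).
      by rewrite !ler_pM2l ?invr_gt0.
    by rewrite le_eqVlt; apply/orP; left; apply/eqP; field; rewrite !gt_eqF.
  by rewrite [leRHS](splitr e) lerD2l.
- by apply/ltW/hN; rewrite /= /n leq_maxl.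
Qed.

End step_inputs.

(** If [S z = 0], the graph form of the resolvent puts [(0, - z)] in the generator; but the
    difference quotients at 0 vanish, so z = 0. *)
Lemma resolvent_inj (R : realType) (X : completeNormedModType R[i])
    (T : R -> X -> X) (b : R[i]) (S : X -> X) :
  C0_semigroup T -> is_resolvent (generator T) b S -> injective S.
Proof.
move=> [bT _ _ _] [bS hS] x y xy; apply/eqP; rewrite -subr_eq0; apply/eqP.
have S0 : 0 = S (x - y) by rewrite (linB bS.1) xy subrr.
set z := x - y in S0 *; have := (hS 0 z).2 S0.
rewrite /generator/= scaler0 sub0r => /cvg_rnormP h.
apply/eqP; rewrite -rnorm_eq0 eq_le rnorm_ge0 andbT.
apply/ler_addgt0Pl => e e0; rewrite addr0.
have [d /= d0 hd] := h _ e0.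
have d2 : 0 < d / 2 by rewrite divr_gt0.
have := hd (d / 2); rewrite /= sub0r normrN gtr0_norm// gtr_pMr// invf_lt1// ltr1n.
move=> /(_ isT d2); rewrite (lin0 (bT _ (ltW d2)).1) subr0 scaler0 sub0r opprK.
exact: ltW.
Qed.

Theorem theorem3p3 (R : realType)
    (X : completeNormedModType R[i]%C) (hX : hilbert X)
    (A : set (X * X)%type) (T : R -> X -> X)
    (hA : generates A T) (hT : left_invertible T)
    (Xm1 : completeNormedModType R[i]%C) (j : X -> Xm1)
    (hXm1 : extrapolation_space A j)
    (Tm1 : R -> Xm1 -> Xm1) (hTm1 : extends_semigroup j T Tm1)
    (U : completeNormedModType R[i]%C) (hU : hilbert U) :
  admissible j Tm1 U +oo%E = admissible j Tm1 U 2%:E.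
Proof.
have [semT AE] := hA; have [semTm1 Tm1j] := hTm1.
have [b [S [resS lj jS _]]] := hXm1; rewrite AE in resS.
(* On [X] the extrapolation norm is |S x|: [j] inherits boundedness and injectivity from the
   resolvent. *)
have jn x : rnorm (j x) = rnorm (S x) by rewrite /rnorm jS.
have bj : bounded_linear j.
  by split=> //; have [[_ [M hM]] _] := resS; exists M => x; rewrite jn.
have ij : injective j.
  move=> x y xy; apply: (resolvent_inj semT resS); apply/eqP.
  rewrite -subr_eq0 -(linB resS.1.1) -rnorm_eq0 -jn (linB lj) xy subrr.
  by rewrite rnorm0.
apply/seteqP; split=> B [bB admB]; split=> // t0 u t00 hu; last first.
  by apply: admB => //; exact: LpB_pinfty_sub2.
by apply: (L2_input semT semTm1 bj ij bB Tm1j admB _ _ hT) => //;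
  exact: hilbert_parallelogram.
Qed.
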